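(* Let $\mathbf{P}\subset\mathbf{GL}^0(\ell\oplus\ell^\diamond)$ be the stabilizer of the subspace $0\oplus\ell^\diamond$. The orbits of $\mathbf{P}$ on $\mathbf{Gr}^0$ are enumerated by $$k:=\dim\bigl(L\cap(0\oplus\ell^\diamond)\bigr),\qquad k=0,1,2,\dots,$$ i.e. for each $k=0,1,2,\dots$ the set of $L\in\mathbf{Gr}^0$ with $\dim(L\cap(0\oplus\ell^\diamond))=k$ is exactly one orbit, and these are all the orbits. The $\mu$-measure of the orbit with number $k$ is $$\frac{q^{-k^2}}{\prod_{j=1}^k(1-q^{-j})^2}.$$
   Context: Spaces and group. $\mathbb{F}_q$ is a finite field. $\ell$ is the direct sum of countably many copies of $\mathbb{F}_q$ (basis $e_1,e_2,\dots$), with the discrete topology; $\ell^\diamond$ is the direct product of countably many copies of $\mathbb{F}_q$ (coordinate vectors $f_1,f_2,\dots$; elements are formal infinite combinations $\sum w_j f_j$), with the product topology (compact). $\ell\oplus\ell^\diamond$ has the product topology. Elements are written as row vectors and operators act on the right: $v\mapsto vg$. $\mathbf{GL}(\ell\oplus\ell^\diamond)$ is the group of all continuous linear operators $g=\begin{pmatrix}a&b\\c&d\end{pmatrix}$ in $\ell\oplus\ell^\diamond$ having a continuous inverse. For such $g$, the block $a:\ell\to\ell$ has finite-dimensional kernel and an image of finite codimension, and $\theta(g):=\dim(\ell/\ell a)-\dim\ker a$ is a homomorphism $\mathbf{GL}(\ell\oplus\ell^\diamond)\to\mathbb{Z}$; $\mathbf{GL}^0(\ell\oplus\ell^\diamond)$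 is its kernel. Grassmannian. For any infinite matrix $T$ over $\mathbb{F}_q$ let $\mathrm{graph}(T)=\{v\oplus vT: v\in\ell\}$; $\mathcal{M}$ is the set of all such subspaces of $\ell\oplus\ell^\diamond$. A subspace $M\subset\ell\oplus\ell^\diamond$ is semi-infinite if there is $L\in\mathcal{M}$ with $\dim L/(L\cap M)<\infty$ and $\dim M/(L\cap M)<\infty$; it has relative dimension $0$ if these two dimensions are equal (this does not depend on $L$). $\mathbf{Gr}^0$ is the set of semi-infinite subspaces of relative dimension $0$; $\mathbf{GL}^0(\ell\oplus\ell^\diamond)$ acts on it by $L\mapsto Lg$. Borel structure and measure. For finite subsets $\Omega,\Xi\subset\mathbb{N}$ let $V[\Omega,\Xi]$ be spanned by the $e_i$, $i\notin\Omega$, and the $f_j$, $j\in\Xi$, and let $W[\Omega,\Xi]$ be the topological direct sum of the lines $\mathbb{F}_q e_i$, $i\in\Omega$, and $\mathbb{F}_q f_j$, $j\notin\Xi$ (infinite combinations of the $f_j$ allowed). The chart $\mathcal{M}[\Omega,\Xi]$ is the set of graphs of linear operators $V[\Omega,\Xi]\to W[\Omega,\Xi]$; it is identified via matrix entries with a countable product of copies of $\mathbb{F}_q$. The charts with $\#\Omega=\#\Xi$ cover $\mathbf{Gr}^0$. A subset of $\mathbf{Gr}^0$ is Borel if its intersection with each chart is Borel for the product topology of that chart. $\mu$ is the $\mathbf{GL}^0(\ell\oplus\ell^\diamond)$-invariant finite Borel measure on $\mathbf{Gr}^0$, unique up to a scalar, normalized by $\mu(\mathcal{M})=1$ (its restriction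 to each chart $\mathcal M[\Omega,\Xi]$ with $\#\Omega=\#\Xi$ is the product of uniform probability measures on the copies of $\mathbb{F}_q$). *)

(* Defs.v *)
From HB Require Import structures.
From mathcomp Require Import all_boot all_order all_algebra finmap.
From mathcomp Require Import all_classical all_reals all_analysis.

Set Implicit Arguments.
Unset Strict Implicit.
Unset Printing Implicit Defensive.

Import Order.TTheory GRing.Theory Num.Theory.

Local Open Scope classical_set_scope.
Local Open Scope ring_scope.

(* The direct sum of countably many copies of F is encoded as {poly F}, with
   e_i = 'X^i (indices start at 0); the ring structure plays no role. *)
Definition ell (F : finFieldType) : Type := {poly F}.
HB.instance Definition _ (F : finFieldType) :=
  GRing.Lmodule.copy (ell F) {poly F}.
HB.instance Definition _ (F : finFieldType) :=
  Topological.copy (ell F) (discrete_topology {poly F}).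

Definition elld (F : finFieldType) : Type := nat -> F.
HB.instance Definition _ (F : finFieldType) :=
  GRing.Lmodule.copy (elld F) (nat -> F^o).
HB.instance Definition _ (F : finFieldType) :=
  Topological.copy (elld F) {ptws nat -> discrete_topology F}.

Notation ellsum F := (ell F * elld F)%type.

Section Dimension.
Variables (K : fieldType) (V : lmodType K).
Implicit Types A B : set V.

(* [quot_dim A B n] : A / B has a basis of n elements (B a subspace of the
   subspace A). *)
Definition quot_dim A B (n : nat) : Prop :=
  exists b : 'I_n -> V, (forall i, A (b i)) /\
    forall x, A x -> exists! c : {ffun 'I_n -> K}, B (x - \sum_i c i *: b i).

Definition has_dim A (n : nat) : Prop := quot_dim A [set 0] n.

(* Equal to 0 by default if A / B is infinite-dimensional. *)
Definition qdim A B : nat := xget 0%N [set n | quot_dim A B n].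

End Dimension.

Section GL.
Variable F : finFieldType.

Definition GL : set {linear ellsum F -> ellsum F} :=
  [set g | continuous g /\
    exists h : ellsum F -> ellsum F,
      [/\ cancel g h, cancel h g & continuous h]].

Definition block_a (g : ellsum F -> ellsum F) (v : ell F) : ell F := (g (v, 0)).1.

(* For g in GL both quotients are finite-dimensional, so that the default value
   of qdim does not interfere. *)
Definition theta (g : ellsum F -> ellsum F) : int :=
  (qdim [set: ell F] (range (block_a g)))%:Z
  - (qdim [set v | block_a g v = 0] [set 0])%:Z.

Definition GL0 : set {linear ellsum F -> ellsum F} :=
  [set g | GL g /\ theta g = 0].

Definition sub_elld : set (ellsum F) := [set x | x.1 = 0].

Definition parabolic : set {linear ellsum F -> ellsum F} :=
  [set g | GL0 g /\ g @` sub_elld = sub_elld].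

End GL.

Section Grassmannian.
Variable F : finFieldType.
Implicit Types L : set (ellsum F).

(* Row vector times infinite matrix. *)
Definition vmul (v : ell F) (T : nat -> nat -> F) : elld F :=
  fun j => \sum_(i < size (v : {poly F})) (v : {poly F})`_i * T i j.

Definition graph (T : nat -> nat -> F) : set (ellsum F) :=
  [set (v, vmul v T) | v in [set: ell F]].

Definition is_Gr0 L : Prop :=
  submod_closed (mem L) /\
  exists T n, quot_dim (graph T) (graph T `&` L) n /\
              quot_dim L (graph T `&` L) n.

End Grassmannian.

Section Charts.
Variables (F : finFieldType) (Om Xi : {fset nat}).

(* [inl i] indexes e_i and [inr j] indexes f_j. *)
Definition entry (x : ellsum F) (s : nat + nat) : F :=
  match s with inl i => (x.1 : {poly F})`_i | inr j => x.2 j end.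

(* inV selects the coordinates of V[Om, Xi], and its negation those of
   W[Om, Xi].  Elements of the sum are finite combinations of the e_i by
   construction, while W contains the infinite combinations of the f_j. *)
Definition inV (s : nat + nat) : bool :=
  match s with inl i => i \notin Om | inr j => j \in Xi end.

Definition chartV : set (ellsum F) := [set x | forall s, ~~ inV s -> entry x s = 0].
Definition chartW : set (ellsum F) := [set x | forall s, inV s -> entry x s = 0].

(* Matrices of linear operators V -> W: rows are indexed by the basis of V,
   columns by the coordinates on W, all entries being arbitrary. *)
Definition chart_mx : Type :=
  {ptws {s | inV s} * {s | ~~ inV s} -> discrete_topology F}.
HB.instance Definition _ := Topological.on chart_mx.

Definition chart_mul (v : ellsum F) (T : chart_mx) (s : {s | ~~ inV s}) : F :=
  \sum_(r \in [set: {s | inV s}]) entry v (val r) * T (r, s).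

Definition chart_graph (T : chart_mx) : set (ellsum F) :=
  [set x | exists v w, [/\ chartV v, chartW w, x = v + w &
    forall s, entry w (val s) = chart_mul v T s]].

End Charts.

Section Gr0_charts.
Variable F : finFieldType.

Let lin (V : lmodType F) (l : V -> F) := forall a u v, l (a *: u + v) = a * l u + l v.

Let lin_sum (V : lmodType F) (l : V -> F) n (b : 'I_n -> V) (c : 'I_n -> F) :
  lin l -> l (\sum_i c i *: b i) = \sum_i c i * l (b i).
Proof.
move=> ll.
have l0 : l 0 = 0 by move: (ll (-1) 0 0); rewrite scaler0 addr0 mulN1r addNr.
by elim/big_rec2: _ => // i y1 y2 _ IH; rewrite ll IH.
Qed.

Let submod_sum (V : lmodType F) (A : set V) n (b : 'I_n -> V) (c : 'I_n -> F) :
  submod_closed (mem A) -> (forall i, A (b i)) -> A (\sum_i c i *: b i).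
Proof.
move=> [A0 Al] Ab; elim/big_rec: _ => [|i x _ Ax]; first exact: set_mem.
by apply/set_mem/Al; exact: mem_set.
Qed.

Let quot_dim_dual (V : lmodType F) (A B : set V) n (b : 'I_n -> V)
    (l : 'I_n -> V -> F) :
  (forall i, lin (l i)) -> submod_closed (mem A) -> (forall i, A (b i)) ->
  (forall i j, l i (b j) = (i == j)%:R) ->
  (forall x, A x -> (B x <-> forall i, l i x = 0)) ->
  quot_dim A B n.
Proof.
move=> ll As Ab lb AB; exists b; split=> // x Ax.
have lD i (c : {ffun 'I_n -> F}) : l i (x - \sum_j c j *: b j) = l i x - c i.
  have -> : x - \sum_j c j *: b j = (-1) *: (\sum_j c j *: b j) + x.
    by rewrite scaleN1r addrC.
  rewrite ll mulN1r addrC lin_sum//; congr (_ - _).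
  rewrite (bigD1 i)//= lb eqxx mulr1 big1 ?addr0// => j ji.
  by rewrite lb eq_sym (negbTE ji) mulr0.
have AD (c : {ffun 'I_n -> F}) : A (x - \sum_j c j *: b j).
  rewrite addrC -scaleN1r; apply/set_mem.
  by apply As.2; apply/mem_set => //; exact: submod_sum.
exists [ffun i => l i x]; split.
  by apply/(AB _ (AD _)) => i; rewrite lD ffunE subrr.
move=> c /(AB _ (AD _)) H; apply/ffunP => i; rewrite ffunE.
by apply/eqP; rewrite -subr_eq0 -lD H.
Qed.

Let vmulE (u : ell F) T m j : (size (u : {poly F}) <= m)%N ->
  vmul u T j = \sum_(i < m) (u : {poly F})`_i * T i j.
Proof.
move=> um; rewrite /vmul (big_ord_widen m (fun i => (u : {poly F})`_i * T i j))//.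
rewrite big_mkcond; apply: eq_bigr => i _; case: ltnP => // ui.
by rewrite nth_default// mul0r.
Qed.

Let size_lin (a : F) (u v : ell F) m :
  (size (u : {poly F}) <= m)%N -> (size (v : {poly F}) <= m)%N ->
  (size (((a *: u + v)%R : ell F) : {poly F}) <= m)%N.
Proof.
move=> um vm; apply: leq_trans (size_polyD _ _) _.
by rewrite geq_max vm andbT (leq_trans (size_scale_leq _ _)).
Qed.

Let vmul_lin T j : lin (fun v : ell F => vmul v T j).
Proof.
move=> a u v; set m := maxn (size (u : {poly F})) (size (v : {poly F})).
have um : (size (u : {poly F}) <= m)%N by rewrite leq_maxl.
have vm : (size (v : {poly F}) <= m)%N by rewrite leq_maxr.
rewrite (vmulE _ _ um) (vmulE _ _ vm) (vmulE _ _ (size_lin a um vm)).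
rewrite mulr_sumr -big_split/=; apply: eq_bigr => i _.
by rewrite coefD coefZ mulrDl mulrA.
Qed.

Lemma graphP (T : nat -> nat -> F) (x : ellsum F) : graph T x <-> forall j, x.2 j = vmul x.1 T j.
Proof.
split=> [[v _ <-]//|H]; exists x.1 => //.
by case: x H => x1 x2 /= H; congr pair; apply/funext => j; rewrite H.
Qed.

Lemma submod_graph (T : nat -> nat -> F) : submod_closed (mem (graph T)).
Proof.
split=> [|a u v /set_mem/graphP Hu /set_mem/graphP Hv]; apply/mem_set/graphP => j /=.
  by rewrite (@vmulE 0 T 0 j) ?size_poly0// big_ord0.
by rewrite vmul_lin -Hu -Hv.
Qed.

Lemma quot_dim0 (V : lmodType F) (A : set V) : quot_dim A A 0.
Proof.
exists (fun=> 0); split=> [[]//|x Ax]; exists 0; split.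
  by rewrite big_ord0 subr0.
by move=> c _; apply/ffunP => -[].
Qed.

Lemma graph_Gr0 (T : nat -> nat -> F) : is_Gr0 (graph T).
Proof.
split; first exact: submod_graph.
by exists T, 0%N; rewrite setIid; split; exact: quot_dim0.
Qed.

Section Charts.
Variables Om Xi : {fset nat}.
Variable T : chart_mx F Om Xi.

Let entry_lin s : lin (fun x : ellsum F => entry x s).
Proof. by case: s => i a u v //=; rewrite coefD coefZ. Qed.

Let rows m : seq {s | inV Om Xi s} :=
  pmap insub ([seq inl i | i <- iota 0 m] ++ [seq inr j | j <- Xi]).

Let chart_mulE (x : ellsum F) s m : (size (x.1 : {poly F}) <= m)%N ->
  chart_mul x T s = \sum_(r <- rows m) entry x (val r) * T (r, s).
Proof.
move=> xm; rewrite /chart_mul (@fsbigE _ _ _ _ _ (rows m))//.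
- by apply: eq_bigl => r; rewrite in_setT.
- rewrite /rows; apply: pmap_sub_uniq; rewrite cat_uniq map_inj_uniq ?iota_uniq; last by move=> ? ? [].
  rewrite map_inj_uniq ?fset_uniq ?andbT/=; last by move=> ? ? [].
  by apply/hasPn => y /mapP[j _ ->]; apply/mapP => -[].
- move=> [[i|j] r] _; rewrite mem_pmap_sub mem_cat => /norP[/= H1 H2].
    rewrite nth_default ?mul0r// (leq_trans xm)// leqNgt.
    by apply: contra H1 => im; rewrite mem_map ?mem_iota// => ? ? [].
  by case/negP: H2; rewrite mem_map// => ? ? [].
Qed.

Let chart_mul_lin s : lin (fun x => chart_mul x T s).
Proof.
move=> a u v; set m := maxn (size (u.1 : {poly F})) (size (v.1 : {poly F})).
have um : (size (u.1 : {poly F}) <= m)%N by rewrite leq_maxl.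
have vm : (size (v.1 : {poly F}) <= m)%N by rewrite leq_maxr.
rewrite (chart_mulE s um) (chart_mulE s vm) (chart_mulE s (size_lin a um vm : (size ((a *: u + v)%R.1 : {poly F}) <= m)%N)).
rewrite mulr_sumr -big_split/=; apply: eq_bigr => i _.
by rewrite entry_lin mulrDl mulrA.
Qed.

Let chart_mul_ext (x y : ellsum F) s :
  (forall r, inV Om Xi r -> entry x r = entry y r) -> chart_mul x T s = chart_mul y T s.
Proof. by move=> xy; apply: eq_fsbigr => -[r rV] _ /=; rewrite xy. Qed.

Lemma chartP (x : ellsum F) :
  chart_graph T x <-> forall s, entry x (val s) = chart_mul x T s.
Proof.
split=> [[v [w [Vv Ww xvw H]]] s|H].
  have -> : chart_mul x T s = chart_mul v T s.
    by apply: chart_mul_ext => r rV; rewrite xvw -[v]scale1r entry_lin mul1r Ww// addr0 scale1r.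
  by rewrite xvw -[v]scale1r entry_lin mul1r Vv ?(valP s)// add0r scale1r H.
pose v : ellsum F := (\poly_(i < size (x.1 : {poly F})) (if i \notin Om then (x.1 : {poly F})`_i else 0),
   fun j => if j \in Xi then x.2 j else 0).
have vE s : entry v s = if inV Om Xi s then entry x s else 0.
  case: s => i //=; rewrite coef_poly; case: ltnP => // h; case: ifP => // _.
  by rewrite nth_default.
have wE s : entry (x - v) s = if inV Om Xi s then 0 else entry x s.
  rewrite addrC -scaleN1r entry_lin vE mulN1r.
  by case: ifP; rewrite ?addNr ?oppr0 ?add0r.
exists v, (x - v); split.
- by move=> s /negbTE sV; rewrite vE sV.
- by move=> s sV; rewrite wE sV.
- by rewrite addrC subrK.
- move=> s; rewrite wE (negbTE (valP s)) H; apply: chart_mul_ext => r rV.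
  by rewrite vE rV.
Qed.

Lemma submod_chart : submod_closed (mem (chart_graph T)).
Proof.
split=> [|a u v /set_mem/chartP Hu /set_mem/chartP Hv]; apply/mem_set/chartP => s.
  rewrite /chart_mul fsbig1; first by case: (val s) => i //=; rewrite coef0.
  by move=> [[i|j] r] _ /=; rewrite ?coef0 mul0r.
by rewrite chart_mul_lin -Hu -Hv entry_lin.
Qed.

Let T0 (i j : nat) : F :=
  if insub (inl i) is Some r then
    if insub (inr j) is Some s then T (r, s) else 0 else 0.

Let T0_chart_mul (x : ellsum F) s j : val s = inr j ->
  (forall k, k \in Xi -> x.2 k = 0) -> chart_mul x T s = vmul x.1 T0 j.
Proof.
move=> sj xX; rewrite (chart_mulE s (leqnn _)) /rows big_pmap big_cat !big_map/= [X in _ + X]big1_seq ?addr0.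
  rewrite /vmul -[RHS](big_mkord xpredT (fun i => (x.1 : {poly F})`_i * T0 i j)) /index_iota subn0.
  apply: eq_bigr => i _; rewrite /T0 -sj valK; case: insubP => [r _ /= ri|_ /=]; last by rewrite mulr0.
  by rewrite ri.
move=> k /andP[_ kX]; case: insubP => [r _ /= rk|//].
by rewrite rk /= xX// mul0r.
Qed.

Let T0X (v : ell F) j : j \in Xi -> vmul v T0 j = 0.
Proof.
move=> jX; rewrite /vmul big1// => i _; rewrite /T0.
case: insubP => [r _ _|]; last by rewrite mulr0.
by case: insubP => [s|]; rewrite /= ?jX// mulr0.
Qed.

Let N := (\max_(i <- Om) i).+1.

Let c (v : ellsum F) (s : nat + nat) : F :=
  if insub s is Some s' then chart_mul v T s' else entry v s.

Let lift (v : ellsum F) : ellsum F :=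
  (\poly_(i < maxn (size (v.1 : {poly F})) N) c v (inl i), fun j => c v (inr j)).

Let lift_entry v s : entry (lift v) s = c v s.
Proof.
case: s => i //=; rewrite coef_poly leq_max.
case: ltnP => //= iv; case: ltnP => // iN.
rewrite /c; case: insubP => [s /=|_]; last by rewrite /= nth_default.
rewrite negbK => iO; move: iN; rewrite ltnNge => /negP[].
exact: (leq_bigmax_seq (P := xpredT) (F := id) i iO isT).
Qed.

Let lift_chart v : chart_graph T (lift v).
Proof.
apply/chartP => s; rewrite lift_entry /c valK.
by apply: chart_mul_ext => r rV; rewrite lift_entry /c insubN// rV.
Qed.

Lemma chart_Gr0 : #|` Om| = #|` Xi| -> is_Gr0 (chart_graph T).
Proof.
move=> OX; split; first exact: submod_chart.
exists T0, #|` Xi|.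
have inX (j : 'I_#|`Xi|) : nth 0%N Xi j \in Xi by rewrite mem_nth.
have inO (j : 'I_#|`Xi|) : nth 0%N Om j \in Om by rewrite mem_nth// OX.
have XE k : k \in Xi -> exists j : 'I_#|`Xi|, k = nth 0%N Xi j.
  by move=> kX; move: (kX); rewrite -index_mem => h; exists (Ordinal h); rewrite /= nth_index.
have OE k : k \in Om -> exists j : 'I_#|`Xi|, k = nth 0%N Om j.
  by move=> kX; move: (kX); rewrite -index_mem OX => h; exists (Ordinal h); rewrite /= nth_index.
have soP (i : 'I_#|`Xi|) : ~~ inV Om Xi (inl (nth 0%N Om i)) by rewrite /= inO.
pose so (i : 'I_#|`Xi|) : {s | ~~ inV Om Xi s} := Sub (inl (nth 0%N Om i)) (soP i).
split.
- apply: (@quot_dim_dual _ _ _ #|`Xi| (fun i : 'I_#|`Xi| => (('X^(nth 0%N Om i) : {poly F}), 0) : ellsum F)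
    (fun (i : 'I_#|`Xi|) x => entry x (val (so i)) - chart_mul x T (so i))).
  + by move=> i a u v; rewrite entry_lin chart_mul_lin mulrBr opprD addrACA.
  + exact: submod_graph.
  + move=> i; apply/graphP => j /=; rewrite /vmul big1// => k _.
    rewrite coefXn; case: eqP => [->|_]; last by rewrite mul0r.
    by rewrite /T0 insubN ?mulr0//= inO.
  + move=> i j; rewrite /chart_mul fsbig1 ?subr0/=.
      by rewrite coefXn nth_uniq ?fset_uniq ?OX.
    move=> [[k|k] r] _ /=; last by rewrite mul0r.
    rewrite coefXn; case: (k =P nth 0%N Om j) => [kj|_]; last by rewrite mul0r.
    by exfalso; move: (r); rewrite /= kj inO.
  + move=> x Gx; have xX k : k \in Xi -> x.2 k = 0.
      by move=> kX; rewrite ((graphP _ _).1 Gx) T0X.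
    split=> [[_ /chartP Cx] i|lx]; first by rewrite Cx subrr.
    split=> //; apply/chartP => s; case sE: (val s) => [i|j].
      have := valP s; rewrite sE /= negbK => /OE[k ik].
      have -> : s = so k by apply: val_inj; rewrite sE ik.
      move/eqP: (lx k); rewrite subr_eq0 => /eqP <-.
      by rewrite ik.
    by rewrite (T0_chart_mul sE xX)/= ((graphP _ _).1 Gx).
- pose v (i : 'I_#|`Xi|) : ellsum F := (0, fun k => (k == nth 0%N Xi i)%:R).
  apply: (@quot_dim_dual _ _ _ #|`Xi| (fun i : 'I_#|`Xi| => lift (v i))
    (fun (i : 'I_#|`Xi|) x => entry x (inr (nth 0%N Xi i)))).
  + by move=> i; exact: entry_lin.
  + exact: submod_chart.
  + by move=> i; exact: lift_chart.
  + move=> i j; rewrite lift_entry /c insubN ?negbK/= ?inX//.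
    by rewrite nth_uniq ?fset_uniq.
  + move=> x Cx; split=> [[/graphP Gx _] i /=|lx]; first by rewrite Gx T0X.
    have xX k : k \in Xi -> x.2 k = 0 by move=> /XE[j ->]; exact: lx.
    split=> //; apply/graphP => j; case: (boolP (j \in Xi)) => jX.
      by rewrite xX// T0X.
    pose s : {s | ~~ inV Om Xi s} := Sub (inr j) jX.
    by rewrite -(@T0_chart_mul x s j)// -((chartP _).1 Cx).
Qed.
End Charts.
End Gr0_charts.

Section Borel.
Variable F : finFieldType.

Definition Gr0 : Type := {L : set (ellsum F) | L \in [set L | is_Gr0 L]}.

HB.instance Definition _ := gen_eqMixin Gr0.
HB.instance Definition _ := gen_choiceMixin Gr0.

Definition graph_pt (T : nat -> nat -> F) : Gr0 :=
  exist _ (graph T) (mem_set (graph_Gr0 T)).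

HB.instance Definition _ := isPointed.Build Gr0 (graph_pt (fun _ _ => 0)).

Definition chart_pt (Om Xi : {fset nat}) (h : #|` Om| = #|` Xi|)
    (T : chart_mx F Om Xi) : Gr0 :=
  exist _ (chart_graph T) (mem_set (chart_Gr0 T h)).

Definition Gr0_Borel : set (set Gr0) :=
  [set B | forall (Om Xi : {fset nat}) (h : #|` Om| = #|` Xi|),
    <<s (@open (chart_mx F Om Xi)) >> (chart_pt h @^-1` B)].

Let Gr0_Borel0 : Gr0_Borel set0.
Proof. by move=> Om Xi h; rewrite preimage_set0; exact: sigma_algebra0. Qed.

Let Gr0_BorelC B : Gr0_Borel B -> Gr0_Borel (~` B).
Proof.
move=> mB Om Xi h; rewrite preimage_setC -setTD.
by apply: sigma_algebraCD; exact: mB.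
Qed.

Let Gr0_Borel_bigcup (B : (set Gr0)^nat) :
  (forall i, Gr0_Borel (B i)) -> Gr0_Borel (\bigcup_i B i).
Proof.
move=> mB Om Xi h; rewrite preimage_bigcup.
by apply: sigma_algebra_bigcup => i; exact: mB.
Qed.

HB.instance Definition _ := @isMeasurable.Build default_measure_display Gr0
  Gr0_Borel Gr0_Borel0 Gr0_BorelC Gr0_Borel_bigcup.

(* The set M of graphs of all infinite matrices. *)
Definition graphs : set Gr0 := range graph_pt.

(* The set Bg; operators, which act on row vectors on the right in the source,
   are applied here as functions: g x stands for xg. *)
Definition translate (g : ellsum F -> ellsum F) (B : set Gr0) : set Gr0 :=
  [set L' | exists2 L, B L & val L' = g @` val L].

Definition parabolic_orbit (L : Gr0) : set Gr0 :=
  [set L' | exists2 g, parabolic g & val L' = g @` val L].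

Definition parabolic_orbits : set (set Gr0) := range parabolic_orbit.

Definition stratum (k : nat) : set Gr0 :=
  [set L | has_dim (val L `&` @sub_elld F) k].

End Borel.

(* Main.v *)
Require Import Defs.
From HB Require Import structures.
From mathcomp Require Import all_boot all_order all_algebra finmap.
From mathcomp Require Import all_classical all_reals all_analysis.
From mathcomp Require Import zify ring.

Set Implicit Arguments.
Unset Strict Implicit.
Unset Printing Implicit Defensive.

Import Order.TTheory GRing.Theory Num.Theory.

Local Open Scope classical_set_scope.
Local Open Scope ring_scope.

(** Order the coordinates as e_i with decreasing i, followed by f_0, f_1, and so
    on.  Every nonzero vector then has a first nonzero entry, and a subspace L
    has a set of pivots, the positions of the first nonzero entries of its
    vectors.  If L is semi-infinite of relative dimension 0, its pivots are the
    e_i with i outside a finite set Om and the f_j with j in a finite set Xi of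
    the same cardinality ([Gr0_pivots]).  Hence Gr^0 is the disjoint union of
    countably many cells, indexed by the pairs (Om, Xi), and on such a cell the
    intersection of L with the dual has dimension #|Xi| ([has_dim_pivots]).

    Orbits.  The dimension of the intersection with the dual is an invariant of
    the parabolic subgroup.  Conversely, two points L and M of one cell have a
    common complement W spanned by coordinate vectors.  If p and q are the
    projections onto L and M along W, the map sending x to x - p x + q x
    carries L to M, and it preserves the dual because L and M are in echelon
    form ([conjugate_same_pivots]).  Transpositions of the e_i and of the f_j
    connect the cells with the same k ([chartV_conjugate]).  All these
    operators have index 0, since an invertible operator that preserves the
    dual is invertible modulo the dual ([parabolicP]).

    Measure.  In the chart [Om, Xi] the cell is given by the vanishing of
    finitely many matrix entries: the k^2 entries with row f_j and column e_m,
    and two families of sizes |lambda| and |mu|, where lambda and mu are the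
    partitions whose parts count the gaps below the elements of Om and of Xi.
    A transvection x + c x_r e_s belongs to GL^0 and adds c to a single matrix
    entry, so that by invariance each condition on an entry multiplies the
    measure by 1/q ([measure_cylinder]).  Charts that differ by exchanging e_i
    for f_j have the same measure, since the matrices with entry 1 at the pivot
    describe the same subspaces in both ([pivot_exchange]); so every chart has
    the measure 1 of the set of graphs.  The measure of a cell is therefore
    q^-(k^2 + |lambda| + |mu|), and the sum over all pairs of partitions with
    at most k parts is the product formula ([esum_weight]). *)

(** * Subspaces and relative dimension *)

Section Dimension.
Variables (K : fieldType) (V : lmodType K).
Implicit Types L B I : set V.

Definition subspace L : Prop :=
  L 0 /\ forall a u v, L u -> L v -> L (a *: u + v).

Lemma subspaceP L : submod_closed (mem L) <-> subspace L.
Proof.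
split=> [[L0 LD]|[L0 LD]]; split.
- exact: set_mem.
- by move=> a u v /mem_set Lu /mem_set Lv; apply/set_mem/LD.
- exact: mem_set.
- by move=> a u v /set_mem Lu /set_mem Lv; apply/mem_set/LD.
Qed.

Lemma subspaceD L u v : subspace L -> L u -> L v -> L (u + v).
Proof. by move=> [_ LD] Lu Lv; rewrite -[u]scale1r; exact: LD. Qed.

Lemma subspaceZ L a u : subspace L -> L u -> L (a *: u).
Proof. by move=> [L0 LD] Lu; rewrite -[_ *: _]addr0; exact: LD. Qed.

Lemma subspaceB L u v : subspace L -> L u -> L v -> L (u - v).
Proof. by move=> [_ LD] Lu Lv; rewrite addrC -scaleN1r; exact: LD. Qed.

Lemma subspace_sum L (I : Type) (r : seq I) (P : pred I) (a : I -> K)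
    (b : I -> V) :
  subspace L -> (forall i, P i -> L (b i)) ->
  L (\sum_(i <- r | P i) a i *: b i).
Proof.
move=> sL Lb; elim/big_rec: _ => [|i x Pi Lx]; first by case: sL.
by apply: sL.2 => //; exact: Lb.
Qed.

Lemma subspaceI L M : subspace L -> subspace M -> subspace (L `&` M).
Proof.
move=> [L0 LD] [M0 MD]; split=> // a u v [Lu Mu] [Lv Mv].
by split; [exact: LD|exact: MD].
Qed.

Lemma subspace0 : subspace [set 0].
Proof. by split=> // a u v /= -> ->; rewrite scaler0 addr0. Qed.

Lemma quot_dim_le L B m n : subspace B ->
  quot_dim L B n -> quot_dim L B m -> (n <= m)%N.
Proof.
move=> sB [b [Lb bP]] [b' [Lb' b'P]].
pose c i := sval (cid (b'P _ (Lb i))).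
pose c' i := sval (cid (bP _ (Lb' i))).
have cP i : B (b i - \sum_j c i j *: b' j).
  by rewrite /c; case: cid => d []; rewrite /=.
have c'P i : B (b' i - \sum_j c' i j *: b j).
  by rewrite /c'; case: cid => d []; rewrite /=.
pose C := \matrix_(i < n, j < m) c i j.
pose C' := \matrix_(i < m, j < n) c' i j.
suff /mulmx1_min : C *m C' = 1%:M by [].
apply/row_matrixP => i.
have [d [_ dU]] := bP _ (Lb i).
have d1 : d = [ffun k => (i == k)%:R].
  apply: dU; rewrite (bigD1 i)//= big1 => [|k ki].
    by rewrite ffunE eqxx scale1r addr0 subrr; case: sB.
  by rewrite ffunE eq_sym (negbTE ki) scale0r.
have d2 : d = [ffun k => (C *m C') i k].
  apply: dU.
  have -> : b i - \sum_k [ffun k => (C *m C') i k] k *: b k =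
      (b i - \sum_j c i j *: b' j) +
      \sum_j c i j *: (b' j - \sum_k c' j k *: b k).
    under [X in _ = _ + X]eq_bigr do rewrite scalerBr.
    rewrite sumrB addrA subrK; congr (_ - _).
    under eq_bigr do rewrite ffunE mxE scaler_suml.
    rewrite exchange_big/=; apply: eq_bigr => j _.
    rewrite scaler_sumr; apply: eq_bigr => k _.
    by rewrite scalerA !mxE.
  by apply: subspaceD => //; exact: subspace_sum.
apply/rowP => k; rewrite !mxE.
have := congr1 (fun f : {ffun 'I_n -> K} => f k) d2.
by rewrite d1 !ffunE mxE => ->.
Qed.

Lemma quot_dim_uniq L B m n : subspace B ->
  quot_dim L B n -> quot_dim L B m -> n = m.
Proof.
move=> sB Ln Lm; apply/eqP.
by rewrite eqn_leq (quot_dim_le sB Ln Lm) (quot_dim_le sB Lm Ln).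
Qed.

Lemma quot_dim_dep L I n m (y : 'I_m -> V) : subspace I ->
  quot_dim L I n -> (forall i, L (y i)) -> (n < m)%N ->
  exists2 d : 'I_m -> K, exists i, d i != 0 & I (\sum_i d i *: y i).
Proof.
move=> sI [b [Lb bP]] Ly nm.
pose c i := sval (cid (bP _ (Ly i))).
have cP i : I (y i - \sum_j c i j *: b j).
  by rewrite /c; case: cid => d [].
pose C := \matrix_(i < m, j < n) c i j.
have : kermx C != 0.
  rewrite -mxrank_eq0 mxrank_ker -lt0n subn_gt0.
  exact: leq_ltn_trans (rank_leq_col _) nm.
case/rowV0Pn => u /sub_kermxP uC u0.
have [i ui] : exists i, u 0 i != 0.
  apply/existsP; rewrite -negb_forall; apply: contra u0 => /forallP u0.
  by apply/eqP/rowP => i; rewrite (eqP (u0 i)) mxE.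
exists (u 0); first by exists i.
have -> : \sum_i u 0 i *: y i = \sum_i u 0 i *: (y i - \sum_j c i j *: b j).
  apply/eqP; rewrite -subr_eq0 -sumrB; apply/eqP.
  under eq_bigr do rewrite -scalerBr opprB addrC subrK scaler_sumr.
  rewrite exchange_big big1//= => j _.
  under eq_bigr do rewrite scalerA.
  rewrite -scaler_suml.
  have := congr1 (fun A : 'rV[K]_n => A 0 j) uC.
  rewrite !mxE => uCj.
  rewrite (_ : \sum_i _ = 0) ?scale0r// -[RHS]uCj.
  by apply: eq_bigr => k _; rewrite mxE.
by exact: subspace_sum.
Qed.

End Dimension.

(** * Leading entries and pivots *)

Section Entries.
Variable F : finFieldType.
Implicit Types (x y z : ellsum F) (s t : nat + nat).

Lemma entryP x y : (forall s, entry x s = entry y s) -> x = y.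
Proof.
case: x y => [x1 x2] [y1 y2] xy; congr pair.
  by apply/polyP => i; exact: (xy (inl i)).
by apply/funext => j; exact: (xy (inr j)).
Qed.

Lemma entry0 s : entry (0 : ellsum F) s = 0.
Proof. by case: s => i //=; rewrite coef0. Qed.

Lemma entry_lin a x y s : entry (a *: x + y) s = a * entry x s + entry y s.
Proof. by case: s => i //=; rewrite coefD coefZ. Qed.

Lemma entryD x y s : entry (x + y) s = entry x s + entry y s.
Proof. by rewrite -[x]scale1r entry_lin scale1r mul1r. Qed.

Lemma entryZ a x s : entry (a *: x) s = a * entry x s.
Proof. by rewrite -[a *: x]addr0 entry_lin entry0 addr0. Qed.

Lemma entryB x y s : entry (x - y) s = entry x s - entry y s.
Proof. by rewrite entryD -scaleN1r entryZ mulN1r. Qed.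

Lemma entry_sum (I : Type) (r : seq I) (P : pred I) (a : I -> F)
    (b : I -> ellsum F) s :
  entry (\sum_(i <- r | P i) a i *: b i) s =
  \sum_(i <- r | P i) a i * entry (b i) s.
Proof.
by elim/big_rec2: _ => [|i u v _ <-]; rewrite ?entry0 // entry_lin.
Qed.

Definition unit_vec s : ellsum F :=
  match s with
  | inl i => ('X^i, 0)
  | inr j => (0, fun k => (k == j)%:R)
  end.

Lemma entry_unit s t : entry (unit_vec s) t = (t == s)%:R.
Proof. by case: s t => i [] j //=; rewrite ?coef0// coefXn. Qed.

Lemma entry_large x : exists B, forall i, (B <= i)%N -> entry x (inl i) = 0.
Proof. by exists (size (x.1 : {poly F})) => i /(nth_default 0). Qed.

(** The order in which leading entries are sought: the coordinates on ell
    by decreasing degree, then the coordinates on its dual by increasing index.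
    Only finitely many coordinates on ell are nonzero, so that every nonzero
    vector has a first nonzero entry. *)
Definition before s t : bool :=
  match s, t with
  | inl i, inl i' => (i' < i)%N
  | inl _, inr _ => true
  | inr _, inl _ => false
  | inr j, inr j' => (j < j')%N
  end.

Definition lead x s : Prop :=
  entry x s != 0 /\ forall t, before t s -> entry x t = 0.

Definition pivots (L : set (ellsum F)) : set (nat + nat) :=
  [set s | exists2 x, L x & lead x s].

Lemma before_total s t : [|| s == t, before s t | before t s].
Proof.
case: s t => i [] j //=.
  by case: (ltngtP i j) => [||->]; rewrite ?orbT ?eqxx.
by case: (ltngtP i j) => [||->]; rewrite ?orbT ?eqxx.
Qed.

Lemma before_irr s : before s s = false.
Proof. by case: s => i; rewrite /= ltnn. Qed.

Lemma has_lead x : x != 0 -> exists s, lead x s.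
Proof.
case: x => p w x0.
have [p0|p0] := eqVneq (p : {poly F}) 0.
  have [j wj] : exists j, w j != 0.
    apply: contrapT => /forallNP w0; case/eqP: x0; apply: entryP => -[i|j].
      by rewrite entry0 p0 /= coef0.
    by rewrite entry0; apply/eqP; apply: contrapT => /negP; exact: w0.
  pose k := ex_minn (ex_intro (fun j => w j != 0) j wj).
  exists (inr k); rewrite /lead /k; case: ex_minnP => m wm min_m.
  split=> // -[i|i] /= im; first by rewrite p0 coef0.
  by apply: contraTeq im => /min_m; rewrite -leqNgt.
exists (inl (size (p : {poly F})).-1); split.
  by rewrite /= -lead_coefE lead_coef_eq0.
move=> [i|i] //= pi; rewrite nth_default//.
by rewrite -(prednK (n := size _)) // size_poly_gt0.
Qed.

Lemma pivots_sub (L M : set (ellsum F)) : L `<=` M -> pivots L `<=` pivots M.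
Proof. by move=> LM s [x /LM Mx xs]; exists x. Qed.

Lemma pivots_lead1 (L : set (ellsum F)) s : subspace L -> pivots L s ->
  exists x, [/\ L x, entry x s = 1 & forall t, before t s -> entry x t = 0].
Proof.
move=> sL [x Lx [xs x_s]]; exists ((entry x s)^-1 *: x); split.
- exact: subspaceZ.
- by rewrite entryZ mulVf.
- by move=> t /x_s xt; rewrite entryZ xt mulr0.
Qed.

Definition bounded_dual (V : set (nat + nat)) : Prop :=
  exists B, forall j, V (inr j) -> (j < B)%N.

(** Gaussian elimination: subtracting multiples of the given vectors clears the
    entries of x at the positions of V one after the other.  The bound on the
    dual part of V is what makes the process stop. *)
Lemma elimination (V : set (nat + nat)) (M : set (ellsum F)) :
  bounded_dual V -> subspace M ->
  (forall s, V s -> exists x, [/\ M x, entry x s = 1 &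
     forall t, V t -> before t s -> entry x t = 0]) ->
  forall x, exists2 y, M y & forall s, V s -> entry y s = entry x s.
Proof.
move=> [B VB] sM piv.
(* Positions of V that come later have a smaller rank. *)
pose rk s := match s with inl i => (B + i)%N | inr j => (B - j.+1)%N end.
have rk_inj s t : V s -> V t -> rk s = rk t -> s = t.
  case: s t => i [] j /= Vs Vt st.
  - by congr inl; lia.
  - by have := VB _ Vt; lia.
  - by have := VB _ Vs; lia.
  - by congr inr; have := VB _ Vs; have := VB _ Vt; lia.
have rk_before s t : V s -> V t -> (rk s < rk t)%N -> before t s.
  case: s t => i [] j //= Vs Vt st; [lia|lia|].
  by have := VB _ Vs; have := VB _ Vt; lia.
have main n x : (forall s, V s -> (n <= rk s)%N -> entry x s = 0) ->
    exists2 y, M y & forall s, V s -> entry y s = entry x s.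
  elim: n x => [|n IH] x xn.
    by exists 0; [case: sM|move=> s Vs; rewrite entry0 xn].
  have [[s [Vs sn]]|no] := pselect (exists s, V s /\ rk s = n); last first.
    apply: IH => s Vs; rewrite leq_eqVlt => /orP[/eqP sn|]; last exact: xn.
    by case: no; exists s.
  have [u [Mu us u0]] := piv _ Vs.
  have [|y My yE] := IH (x - entry x s *: u).
    move=> t Vt; rewrite leq_eqVlt entryB entryZ => /orP[/eqP tn|tn].
      by rewrite -(rk_inj s t) ?sn// us mulr1 subrr.
    by rewrite xn// u0 ?mulr0 ?subrr// rk_before// sn.
  exists (y + entry x s *: u); first by apply: subspaceD => //; exact: subspaceZ.
  by move=> t Vt; rewrite entryD yE// entryB subrK.
move=> x; have [A xA] := entry_large x.
apply: (main (B + A)%N) => -[i|j] Vs /=; first by rewrite leq_add2l => /xA.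
by rewrite leqNgt (leq_trans _ (leq_addr _ _))// ltn_subrL (leq_ltn_trans _ (VB _ Vs)).
Qed.

Lemma zero_on_pivots (L : set (ellsum F)) x : L x ->
  (forall s, pivots L s -> entry x s = 0) -> x = 0.
Proof.
move=> Lx x0; apply/eqP; apply: contrapT => /negP /has_lead[s xs].
have /x0 : pivots L s by exists x.
by case: xs => + _ => /eqP.
Qed.

(** Elements of L with distinct leading positions outside pivots I are linearly
    independent modulo I. *)
Lemma pivots_diff_le (L I : set (ellsum F)) n (S : seq (nat + nat)) :
  subspace I -> quot_dim L I n -> uniq S ->
  (forall s, s \in S -> pivots L s /\ ~ pivots I s) -> (size S <= n)%N.
Proof.
move=> sI Ln uS SP; rewrite leqNgt; apply/negP => nS.
pose s_ (i : 'I_(size S)) := nth (inl 0%N) S i.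
have sP i : pivots L (s_ i) /\ ~ pivots I (s_ i) by apply: SP; rewrite mem_nth.
have /choice[y yP] : forall i, exists y, L y /\ lead y (s_ i).
  by move=> i; have [[y Ly ys] _] := sP i; exists y.
have [d [i0 di0] Id] := quot_dim_dep sI Ln (fun i => (yP i).1) nS.
(* The rank makes the first of the leading positions the one of largest rank;
   B exceeds all the indices in the dual part. *)
pose B := \max_(i < size S) (if s_ i is inr j then j.+1 else 0)%N.
pose rk s := match s with inl i => (B + i)%N | inr j => (B - j.+1)%N end.
have [m dm m_max] := @arg_maxnP _ i0 (fun i => d i != 0) (fun i => rk (s_ i)) di0.
have jB i j : s_ i = inr j -> (j < B)%N.
  by move=> ij; rewrite /B (bigD1 i)//= ij leq_max leqnn.
have mP i : d i != 0 -> i != m -> before (s_ m) (s_ i).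
  move=> di im; have := m_max _ di.
  have : s_ i != s_ m by rewrite nth_uniq.
  case E: (s_ i) => [a|a]; case E': (s_ m) => [b|b] //= ab.
  - by have : a <> b by [move=> ba; rewrite ba eqxx in ab]; lia.
  - by have := jB _ _ E'; lia.
  - have : a <> b by move=> ba; rewrite ba eqxx in ab.
    by have := jB _ _ E; have := jB _ _ E'; lia.
case: (sP m) => _; apply; exists (\sum_i d i *: y i) => //.
have zeroE t : t = s_ m \/ before t (s_ m) ->
    entry (\sum_i d i *: y i) t = d m * entry (y m) t.
  move=> tm; rewrite entry_sum (bigD1 m)//= big1 ?addr0// => i im.
  have [->|di] := eqVneq (d i) 0; first by rewrite mul0r.
  have mi := mP _ di im.
  rewrite ((yP i).2.2 t) ?mulr0//.
  case: tm => [->//|]; move: mi.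
  case: t (s_ m) (s_ i) => a [] b [] c //=; first by move=> ? /(ltn_trans _); apply.
  by move=> bc /ltn_trans; apply.
split; first by rewrite zeroE; [rewrite mulf_neq0//; exact: (yP m).2.1|left].
by move=> t tm; rewrite zeroE; [rewrite ((yP m).2.2 t)// mulr0|right].
Qed.

(** Conversely these elements, reduced so as to vanish at the other pivots of L,
    span L modulo I: subtract from x the combination of them and of vectors of
    I that agrees with x at the pivots of L. *)
Lemma quot_dim_pivots (L I : set (ellsum F)) (S : seq (nat + nat)) :
  subspace L -> subspace I -> I `<=` L -> bounded_dual (pivots L) -> uniq S ->
  (forall s, s \in S <-> pivots L s /\ ~ pivots I s) ->
  quot_dim L I (size S).
Proof.
move=> sL sI IL bL uS SP.
pose s_ (i : 'I_(size S)) := nth (inl 0%N) S i.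
have sP i : pivots L (s_ i) /\ ~ pivots I (s_ i) by apply/SP; rewrite mem_nth.
have /choice[b bP] : forall i, exists y, L y /\
    forall t, pivots L t -> entry y t = (t == s_ i)%:R.
  move=> i; have [|y Ly yE] := elimination bL sL _ (unit_vec (s_ i)).
    move=> s Ls; have [x [Lx xs x0]] := pivots_lead1 sL Ls.
    by exists x; split=> // t _; exact: x0.
  by exists y; split=> // t Lt; rewrite yE// entry_unit.
have entry_b (c : 'I_(size S) -> F) i :
    entry (\sum_j c j *: b j) (s_ i) = c i.
  rewrite entry_sum (bigD1 i)//= big1 => [|j ji].
    by rewrite (bP i).2 ?eqxx ?mulr1 ?addr0//; exact: (sP i).1.
  rewrite (bP j).2; last exact: (sP i).1.
  by rewrite nth_uniq// -[(_ : nat) == _]/(i == j) eq_sym (negbTE ji) mulr0.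
have entry_b0 (c : 'I_(size S) -> F) t : pivots L t -> t \notin S ->
    entry (\sum_j c j *: b j) t = 0.
  move=> Lt tS; rewrite entry_sum big1// => j _; rewrite (bP j).2//.
  by case: eqP => [tj|_]; rewrite ?mulr0//; rewrite tj mem_nth in tS.
have free_b (c : 'I_(size S) -> F) : I (\sum_j c j *: b j) -> forall i, c i = 0.
  move=> Ic i; have c0 : \sum_j c j *: b j = 0.
    apply: (zero_on_pivots Ic) => t It; apply: entry_b0.
      exact: pivots_sub It.
    by apply/negP => /SP[].
  by rewrite -(entry_b c) c0 entry0.
exists b; split=> [i|x Lx]; first exact: (bP i).1.
pose M := [set y | exists c : {ffun 'I_(size S) -> F}, I (y - \sum_i c i *: b i)].
have sM : subspace M.
  split=> [|a u v [c cu] [c' c'v]].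
    by exists [ffun=> 0]; under eq_bigr do rewrite ffunE scale0r; rewrite big1// subr0; case: sI.
  exists [ffun i => a * c i + c' i].
  under eq_bigr do rewrite ffunE scalerDl -scalerA.
  rewrite big_split/= -scaler_sumr opprD addrACA -scalerBr.
  exact: sI.2.
have ML : M `<=` L.
  move=> y [c cy]; rewrite -[y](subrK (\sum_i c i *: b i)).
  apply: subspaceD => //; first exact: IL.
  by apply: subspace_sum => // i _; exact: (bP i).1.
have [|y My yx] := elimination bL sM _ x.
  move=> s Ls; have [|sS] := boolP (s \in S).
    move=> /(nthP (inl 0%N))[i iS si]; exists (b (Ordinal iS)).
    have si' : s_ (Ordinal iS) = s by [].
    split.
    - exists [ffun j => (Ordinal iS == j)%:R].
      rewrite (bigD1 (Ordinal iS))//= big1 => [|j ji].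
        by rewrite ffunE eqxx scale1r addr0 subrr; case: sI.
      by rewrite ffunE eq_sym (negbTE ji) scale0r.
    - by rewrite (bP _).2// si' eqxx.
    - move=> t Lt ts; rewrite (bP _).2// si'; case: eqP => // E.
      by rewrite E before_irr in ts.
  have Is : pivots I s by apply: contrapT => nIs; case/negP: sS; apply/SP.
  have [u [Iu us u0]] := pivots_lead1 sI Is.
  exists u; split=> //; last by move=> t _; exact: u0.
  exists [ffun=> 0]; under eq_bigr do rewrite ffunE scale0r.
  by rewrite big1// subr0.
have xy : x = y.
  apply/eqP; rewrite -subr_eq0; apply/eqP/(@zero_on_pivots L).
    by apply: subspaceB => //; exact: ML.
  by move=> s Ls; rewrite entryB yx// subrr.
move: My; rewrite -xy => -[c cx]; exists c; split=> // c' c'x.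
apply/ffunP => i; apply/eqP; rewrite -subr_eq0; apply/eqP.
apply: (free_b (fun i => c i - c' i)).
under eq_bigr do rewrite scalerBl.
rewrite sumrB.
have -> : \sum_i c i *: b i - \sum_i c' i *: b i =
  (x - \sum_i c' i *: b i) - (x - \sum_i c i *: b i).
  by rewrite opprB [RHS]addrC addrA subrK.
exact: subspaceB.
Qed.

End Entries.

(** * Schubert cells and charts *)

Section Cells.
Variable F : finFieldType.
Implicit Types (x y z : ellsum F) (s t r : nat + nat) (L : set (ellsum F)).
Implicit Types (Om Xi : {fset nat}) (V : set (nat + nat)).

Lemma finite_bounded_seq (T : eqType) (A : set T) n :
  (forall S : seq T, uniq S -> (forall s : T, s \in S -> A s) -> (size S <= n)%N) ->
  exists2 S : seq T, uniq S & forall s : T, s \in S <-> A s.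
Proof.
move=> An.
pose P k := `[< exists S : seq T, [/\ uniq S, size S = k & forall s : T, s \in S -> A s] >].
have P0 : exists k, P k by exists 0%N; apply/asboolP; exists [::].
have Pn k : P k -> (k <= n)%N by move=> /asboolP[S [uS <- SA]]; exact: An.
have [k /asboolP[S [uS Sk SA]] kmax] := ex_maxnP P0 Pn.
exists S => // s; split=> [|As]; first exact: SA.
apply: contrapT => /negP sS; have : (k.+1 <= k)%N.
  apply: kmax; apply/asboolP; exists (s :: S); split=> /=.
  - by rewrite sS.
  - by rewrite Sk.
  - by move=> t; rewrite inE => /predU1P[->//|]; exact: SA.
by rewrite ltnn.
Qed.

Lemma seq_fset_of (T : eqType) (f : nat -> T) (S : seq T) :
  injective f -> uniq S -> (forall s : T, s \in S -> exists i, s = f i) ->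
  exists2 A : {fset nat}, #|` A| = size S & forall i, (i \in A) = (f i \in S).
Proof.
move=> f_inj uS Sf.
have [u Su] : exists u : seq nat, S = map f u.
  elim: S Sf {uS} => [|s S IH] Sf; first by exists [::].
  have [i ->] := Sf s (mem_head _ _).
  have [|u ->] := IH; last by exists (i :: u).
  by move=> t tS; apply: Sf; rewrite inE tS orbT.
exists [fset i | i in u]%fset => [|i]; last by rewrite Su mem_map// !inE.
by rewrite Su size_map card_fseq undup_id//; move: uS; rewrite Su map_inj_uniq.
Qed.

Lemma vmulX i (T : nat -> nat -> F) j : vmul ('X^i : {poly F}) T j = T i j.
Proof.
rewrite /vmul size_polyXn big_ord_recr/= big1 ?add0r => [|k _].
  by rewrite coefXn eqxx mul1r.
by rewrite coefXn ltn_eqF ?mul0r//.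
Qed.

Lemma vmul0 (T : nat -> nat -> F) j : vmul (0 : ell F) T j = 0.
Proof. by rewrite /vmul size_poly0 big_ord0. Qed.

Lemma subspace_graph (T : nat -> nat -> F) : subspace (graph T).
Proof. exact/subspaceP/submod_graph. Qed.

Lemma pivots_graph (T : nat -> nat -> F) s :
  pivots (graph T) s <-> exists i, s = inl i.
Proof.
split=> [[x /graphP xT [xs x0]]|[i ->]].
  case: s xs x0 => [i|j] xs x0; first by exists i.
  have x1 : x.1 = 0 by apply/polyP => i; rewrite coef0; exact: (x0 (inl i)).
  by move: xs; rewrite /= xT x1 vmul0 eqxx.
exists ('X^i, vmul ('X^i : {poly F}) T); first by apply/graphP.
split=> [|[k|k] //]; rewrite /= coefXn ?eqxx ?oner_neq0// => ik.
by rewrite gtn_eqF.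
Qed.

(** Let I be the intersection of L with a commensurable graph.  The pivots of the
    graph are all the e_i, and both the graph and L have exactly n pivots that
    I lacks.  The pivots common to these two sets cancel in the count, which
    leaves the e_i that L misses and the pivots f_j of L. *)
Lemma Gr0_pivots L : is_Gr0 L ->
  exists Om Xi, #|` Om| = #|` Xi| /\ pivots L = [set s | inV Om Xi s].
Proof.
move=> [/subspaceP sL [T [n [Gn Ln]]]].
set I := graph T `&` L in Gn Ln.
have sG := subspace_graph T.
have sI : subspace I by exact: subspaceI.
have IG : I `<=` graph T by move=> x [].
have IL : I `<=` L by move=> x [].
have [S1 uS1 S1P] := finite_bounded_seq (fun S => @pivots_diff_le F (graph T) I n S sI Gn).
have [S2 uS2 S2P] := finite_bounded_seq (fun S => @pivots_diff_le F L I n S sI Ln).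
have I_inl s : pivots I s -> exists i, s = inl i.
  by move=> /(pivots_sub IG)/pivots_graph.
have bG : bounded_dual (pivots (graph T)).
  by exists 0%N => j /pivots_graph[].
have bL : bounded_dual (pivots L).
  exists (\max_(s <- S2) if s is inr j then j.+1 else 0)%N => j Lj.
  have jS : inr j \in S2.
    by apply/S2P; split=> // /I_inl[].
  exact: (leq_bigmax_seq (P := xpredT)
    (F := fun s : nat + nat => if s is inr j then j.+1 else 0%N) _ jS isT).
have s1 := quot_dim_uniq sI Gn (quot_dim_pivots sG sI IG bG uS1 S1P).
have s2 := quot_dim_uniq sI Ln (quot_dim_pivots sL sI IL bL uS2 S2P).
have [|Om Om1 OmP] := @seq_fset_of _ inl [seq s <- S1 | s \notin S2]
  (fun _ _ => @inl_inj _ _ _ _) (filter_uniq _ uS1).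
  by move=> s; rewrite mem_filter => /andP[_ /S1P[/pivots_graph]].
have [|Xi Xi1 XiP] := @seq_fset_of _ inr [seq s <- S2 | s \notin S1]
  (fun _ _ => @inr_inj _ _ _ _) (filter_uniq _ uS2).
  move=> [i|j]; rewrite mem_filter => /andP[/negP nS1 /S2P[_ nI]]; last by exists j.
  by case: nS1; apply/S1P; split=> //; apply/pivots_graph; exists i.
exists Om, Xi; split.
  rewrite Om1 Xi1.
  have E : size [seq s <- S1 | s \in S2] = size [seq s <- S2 | s \in S1].
    apply/perm_size/uniq_perm; rewrite ?filter_uniq// => s.
    by rewrite !mem_filter andbC.
  have C (S S' : seq (nat + nat)) : (size [seq s <- S | s \in S'] +
      size [seq s <- S | s \notin S'] = size S)%N.
    by rewrite !size_filter count_predC.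
  by apply/eqP; rewrite -(eqn_add2l (size [seq s <- S1 | s \in S2])) C E C -s1 -s2.
apply/seteqP; split=> -[i|j] /=.
- move=> Li; rewrite OmP mem_filter; apply/negP => /andP[/negP nS2 /S1P[_ nI]].
  by apply: nS2; apply/S2P.
- move=> Lj; rewrite XiP mem_filter; apply/andP; split; last first.
    by apply/S2P; split=> // /I_inl[].
  by apply/negP => /S1P[/pivots_graph[]].
- rewrite OmP mem_filter => /negP nS; apply: contrapT => nL.
  apply: nS; apply/andP; split; first by apply/negP => /S2P[].
  apply/S1P; split; first by apply/pivots_graph; exists i.
  by move=> /(pivots_sub IL).
- by rewrite XiP mem_filter => /andP[_ /S2P[]].
Qed.

Lemma bounded_inV Om Xi : bounded_dual [set s | inV Om Xi s].
Proof.
exists (\max_(j <- Xi) j.+1)%N => j /= jXi.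
exact: (leq_bigmax_seq (P := xpredT) (F := fun j => j.+1) _ jXi isT).
Qed.

Lemma has_dim_pivots L Om Xi : subspace L -> pivots L = [set s | inV Om Xi s] ->
  has_dim (L `&` @sub_elld F) #|` Xi|.
Proof.
move=> sL LV.
have sD : subspace (@sub_elld F).
  by split=> // a u v; rewrite /sub_elld /= => -> ->; rewrite scaler0 addr0.
have pE s : pivots (L `&` @sub_elld F) s <-> s \in map inr (enum_fset Xi).
  split=> [[x [Lx x1] xs]|/mapP[j jXi ->]].
    have : pivots L s by exists x.
    rewrite LV; case: s xs => [i|j] [xs _] /=; last by move=> ?; rewrite map_f.
    by rewrite /= x1 coef0 eqxx in xs.
  have : pivots L (inr j) by rewrite LV.
  move=> [x Lx xj]; exists x => //; split=> //.
  by apply/polyP => i; rewrite coef0; exact: (xj.2 (inl i)).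
have p0 s : ~ pivots [set 0 : ellsum F] s.
  by move=> [x -> [+ _]]; rewrite entry0 eqxx.
rewrite /has_dim -(size_map (inr : nat -> nat + nat)).
apply: quot_dim_pivots.
- exact: subspaceI.
- exact: subspace0.
- by move=> x ->; split; [case: sL|].
- have [B BV] := bounded_inV Om Xi; exists B => j /pE/mapP[i iX [->]].
  exact: BV.
- by rewrite map_inj_uniq ?fset_uniq//; exact: inr_inj.
- by move=> s; split=> [/pE sX|[/pE]//]; split=> //; exact: p0.
Qed.

(** L is a complement of the space W of all vectors that vanish at the positions
    of V.  The vectors in the second clause are the rows of the matrix of which
    L is then the graph; with finite Gaussian elimination they suffice to give
    L + W the whole space, also when V is infinite. *)
Definition complements V L : Prop :=
  (forall y, L y -> (forall s, V s -> entry y s = 0) -> y = 0) /\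
  (forall r, V r -> exists2 y, L y & forall s, V s -> entry y s = (s == r)%:R).

(** The entry at (r, s) of the matrix of which L is the graph.  As a relation it
    makes sense for every L, and it only involves the existence of a vector. *)
Definition row_entry V L r s (c : F) : Prop :=
  exists y, [/\ L y, forall t, V t -> entry y t = (t == r)%:R & entry y s = c].

Lemma complements_inj V L y z : subspace L -> complements V L -> L y -> L z ->
  (forall s, V s -> entry y s = entry z s) -> y = z.
Proof.
move=> sL [LV _] Ly Lz yz; apply/eqP; rewrite -subr_eq0; apply/eqP/LV.
  exact: subspaceB.
by move=> s Vs; rewrite entryB yz// subrr.
Qed.

Lemma complements_ex V L x : bounded_dual V -> subspace L -> complements V L ->
  exists2 y, L y & forall s, V s -> entry y s = entry x s.
Proof.
move=> bV sL [_ LV]; apply: elimination => // r Vr.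
have [y Ly yr] := LV _ Vr; exists y; split=> // [|t Vt tr].
  by rewrite yr// eqxx.
by rewrite yr//; case: eqP => // E; rewrite E before_irr in tr.
Qed.

Lemma row_entry_uniq V L r s c c' : subspace L -> complements V L ->
  row_entry V L r s c -> row_entry V L r s c' -> c = c'.
Proof.
move=> sL LV [y [Ly yr <-]] [z [Lz zr <-]].
by rewrite (complements_inj sL LV Ly Lz)// => t Vt; rewrite yr// zr.
Qed.

Lemma row_entry_ex V L r s : complements V L -> V r ->
  exists c, row_entry V L r s c.
Proof. by move=> [_ LV] /LV[y Ly yr]; exists (entry y s), y. Qed.

(** With respect to its own pivots a subspace is in reduced echelon form: a row
    vanishes at all the pivots but one, which must be its leading position. *)
Lemma pivotsE V L : bounded_dual V -> subspace L ->
  pivots L = V <-> complements V L /\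
    forall r s, V r -> ~ V s -> before s r -> row_entry V L r s 0.
Proof.
move=> bV sL; split=> [LV|[cL re]].
  have cL : complements V L.
    split=> [y Ly y0|r Vr].
      by apply: (zero_on_pivots Ly); rewrite LV.
    have [|y Ly yr] := elimination bV sL _ (unit_vec F r).
      move=> s; rewrite -LV => /(pivots_lead1 sL)[x [Lx xs x0]].
      by exists x; split=> // t _; exact: x0.
    by exists y => // s Vs; rewrite yr// entry_unit.
  split=> // r s Vr nVs sr; have [y Ly yr] := cL.2 _ Vr.
  exists y; split=> //.
  have [|t [yt y_t]] := @has_lead F y.
    by apply/eqP => y0; move: (yr _ Vr); rewrite y0 entry0 eqxx => /esym/eqP; rewrite oner_eq0.
  have Vt : V t by rewrite -LV; exists y.
  move: (yt); rewrite yr//; case: (t =P r) => [tr _|_]; last by rewrite eqxx.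
  by rewrite y_t ?tr.
have lead_row r y : V r -> L y -> (forall s, V s -> entry y s = (s == r)%:R) -> lead y r.
  move=> Vr Ly yr; split; first by rewrite yr// eqxx oner_neq0.
  move=> t tr; have [Vt|nVt] := pselect (V t).
    by rewrite yr//; case: eqP => // E; rewrite E before_irr in tr.
  have [z [Lz zr zt]] := re _ _ Vr nVt tr.
  by rewrite (complements_inj sL cL Ly Lz)// => s Vs; rewrite yr// zr.
apply/seteqP; split=> [s [x Lx [xs x_s]]|r Vr]; last first.
  by have [y Ly yr] := cL.2 _ Vr; exists y => //; exact: lead_row.
apply: contrapT => nVs.
(* Before s the vector x vanishes, so that it is a combination y of the rows of
   pivots after s; these rows vanish at s. *)
pose V' := [set r | V r /\ before s r].
have bV' : bounded_dual V' by have [B VB] := bV; exists B => j [/VB].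
pose M := L `&` [set y | forall t, ~ V' t -> V t \/ t = s -> entry y t = 0].
have sM : subspace M.
  apply: subspaceI => //; split=> [t _ _|a u v u0 v0 t nt ts]; first by rewrite entry0.
  by rewrite entry_lin u0// v0// mulr0 addr0.
have [|y [Ly y0] yx] := elimination bV' sM _ x.
  move=> r [Vr sr]; have [y Ly yr] := cL.2 _ Vr.
  exists y; split=> //; last first.
  - move=> t [Vt _] tr; rewrite yr//; case: eqP => // E.
    by rewrite E before_irr in tr.
  - by rewrite yr// eqxx.
  split=> // t nt [Vt|->]; last exact: (lead_row _ _ Vr Ly yr).2 _ sr.
  rewrite yr//; case: eqP => // E; case: nt; split; by rewrite E.
have xy : x = y.
  apply: (complements_inj sL cL Lx Ly) => t Vt.
  have [V't|nV't] := pselect (V' t); first by rewrite yx.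
  rewrite y0//; last by left.
  apply: x_s; case/or3P: (before_total t s) => [/eqP E|//|ts].
    by case: nVs; rewrite -E.
  by case: nV't.
move: xs; rewrite xy y0 ?eqxx//; last by right.
by move=> [].
Qed.

Lemma complements_eq V L G : bounded_dual V -> subspace L -> subspace G ->
  complements V L ->
  (forall y, G y -> (forall s, V s -> entry y s = 0) -> y = 0) ->
  (forall r y, V r -> L y -> (forall s, V s -> entry y s = (s == r)%:R) -> G y) ->
  L = G.
Proof.
move=> bV sL sG cL G0 LG.
have cI : complements V (L `&` G).
  split=> [y [Ly _]|r Vr]; first exact: cL.1.
  by have [y Ly yr] := cL.2 _ Vr; exists y => //; split=> //; exact: LG yr.
have sI := subspaceI sL sG.
apply/seteqP; split=> x Hx; have [y [Ly Gy] yx] := complements_ex x bV sI cI.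
  by rewrite (complements_inj sL cL Hx Ly)// => s Vs; rewrite yx.
suff -> : x = y by [].
apply/eqP; rewrite -subr_eq0; apply/eqP/G0; first exact: subspaceB.
by move=> s Vs; rewrite entryB yx// subrr.
Qed.

Lemma chart_kernel Om Xi (T : chart_mx F Om Xi) y : chart_graph T y ->
  (forall s, inV Om Xi s -> entry y s = 0) -> y = 0.
Proof.
move=> /chartP yT y0; apply: entryP => s; rewrite entry0.
have [Vs|nVs] := boolP (inV Om Xi s); first exact: y0.
have -> := yT (Sub s nVs).
by rewrite /chart_mul fsbig1// => r _; rewrite y0 ?mul0r//; exact: valP.
Qed.

Lemma complements_chart Om Xi L : subspace L ->
  complements [set s | inV Om Xi s] L ->
  exists T : chart_mx F Om Xi, L = chart_graph T.
Proof.
move=> sL cL; set V := [set s | _] in cL.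
have /choice[y yP] : forall r : {s | inV Om Xi s}, exists y, L y /\
    forall s, V s -> entry y s = (s == val r)%:R.
  by move=> r; have [y Ly yr] := cL.2 _ (valP r); exists y.
exists (fun p => entry (y p.1) (val p.2)).
apply: (complements_eq (bounded_inV Om Xi)) => //.
- exact/subspaceP/submod_chart.
- exact: chart_kernel.
move=> r z Vr Lz zr.
have -> : z = y (Sub r Vr).
  apply: (complements_inj sL cL Lz (yP _).1) => s Vs.
  by rewrite zr// (yP _).2.
apply/chartP => s; rewrite /chart_mul.
rewrite (@fsbigE _ _ _ _ _ [:: Sub r Vr])//= ?big_cons ?big_nil.
- have -> : entry (y (Sub r Vr)) r = 1 by rewrite (yP _).2// eqxx.
  by rewrite in_setT/= mul1r addr0.
- move=> t _; rewrite inE => tr; rewrite (yP _).2; last exact: valP.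
  by rewrite -val_eqE/= in tr; rewrite (negbTE tr) mul0r.
Qed.

Lemma complements_Gr0 Om Xi L : #|` Om| = #|` Xi| -> subspace L ->
  complements [set s | inV Om Xi s] L -> is_Gr0 L.
Proof. by move=> h sL /(complements_chart sL)[T ->]; exact: chart_Gr0. Qed.

Lemma complements_graph (T : nat -> nat -> F) :
  complements [set s | inV fset0 fset0 s] (graph T).
Proof.
split=> [y /graphP yT y0|[i|j]//= _].
  have y1 : y.1 = 0.
    by apply/polyP => i; rewrite coef0; exact: (y0 (inl i)).
  apply: entryP => -[i|j]; rewrite entry0 /= ?y1 ?coef0//.
  by rewrite yT y1 vmul0.
exists ('X^i, vmul ('X^i : {poly F}) T); first exact/graphP.
by move=> [k|k] //= _; rewrite coefXn.
Qed.

Lemma graphsE L : subspace L ->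
  complements [set s | inV fset0 fset0 s] L <-> exists T, L = graph T.
Proof.
move=> sL; split=> [cL|[T ->]]; last exact: complements_graph.
have /choice[y yP] : forall i : nat, exists y, L y /\
    forall k, entry y (inl k) = (k == i)%:R.
  move=> i; have [y Ly yi] := cL.2 (inl i) isT.
  by exists y; split=> // k; rewrite yi.
exists (fun i j => entry (y i) (inr j)).
have bV := bounded_inV fset0 fset0.
apply: (complements_eq bV) => //; first exact: subspace_graph.
  exact: (complements_graph _).1.
move=> [i|j]//= z _ Lz zi.
have -> : z = y i.
  by apply: (complements_inj sL cL Lz (yP i).1) => -[k|//] Vk; rewrite zi// (yP i).2.
apply/graphP => j.
have -> : (y i).1 = 'X^i by apply/polyP => k; rewrite coefXn -(yP i).2.
by rewrite vmulX.
Qed.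

End Cells.

(** * The parabolic subgroup and its orbits *)

Section Group.
Variable F : finFieldType.
Implicit Types (x y z : ellsum F) (s t r : nat + nat) (L M : set (ellsum F)).
Implicit Types (Om Xi : {fset nat}) (f h : ellsum F -> ellsum F).

(** Basic neighbourhoods: ell is discrete and its dual carries the product
    topology. *)
Definition agree (B : nat) x y : Prop :=
  y.1 = x.1 /\ forall j, (j < B)%N -> y.2 j = x.2 j.

Lemma nbhs_agree B x : nbhs x [set y | agree B x y].
Proof.
have c j : nbhs x.2 [set w : elld F | w j = x.2 j].
  have xj : nbhs (x.2 j : discrete_topology F) [set x.2 j].
    exact: (@discrete_set1 (discrete_topology F)).
  exact: (@proj_continuous nat (fun=> discrete_topology F) j x.2 _ xj).
have cB : nbhs x.2 [set w : elld F | forall j, (j < B)%N -> w j = x.2 j].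
  elim: B => [|B IH]; first by apply: filterS (@filterT _ (nbhs x.2) _) => w _ j.
  apply: filterS (filterI IH (c B)) => w [wB wE] j /=.
  by rewrite ltnS leq_eqVlt => /predU1P[->//|]; exact: wB.
exists ([set x.1], [set w : elld F | forall j, (j < B)%N -> w j = x.2 j]).
  by split=> //=; exact: (@discrete_set1 (discrete_topology {poly F})).
by move=> y [/= y1 y2]; split.
Qed.

Definition locally_defined f : Prop :=
  forall n x, exists B, forall y, agree B x y -> agree n (f x) (f y).

Lemma locally_defined_continuous f : locally_defined f -> continuous f.
Proof.
move=> fl x.
have fE n : nbhs x [set y | agree n (f x) (f y)].
  by have [B fB] := fl n x; apply: filterS (nbhs_agree B x).
have c1 : (fun y => (f y).1) @ x --> (f x).1.
  apply/(@discrete_cvg (discrete_topology {poly F})).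
  by apply: filterS (fE 0%N) => y [].
have c2 : (fun y => (f y).2) @ x --> (f x).2.
  apply/cvg_sup => j U [V [[W oW <-] Wf WU]].
  apply: (filterS WU); apply: filterS (fE j.+1) => y [_ /(_ j (ltnSn j)) yj].
  by rewrite /= yj.
have fE' : (fun y => ((f y).1, (f y).2)) = f by apply/funext => y; case: (f y).
have c12 := cvg_pair c1 c2; rewrite fE' in c12.
move=> A; case=> -[P Q] [/= Px Qx] PQA; apply: c12; exists (P, Q) => //.
Qed.

Lemma linear_bundle f : (forall a u v, f (a *: u + v) = a *: f u + f v) ->
  exists g : {linear ellsum F -> ellsum F}, g = f :> (_ -> _).
Proof.
move=> fl; pose fL := GRing.isLinear.Build F (ellsum F) (ellsum F) *:%R f fl.
pose g : {linear ellsum F -> ellsum F} := HB.pack f fL.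
by exists g.
Qed.

Lemma GL_bundle f h : (forall a u v, f (a *: u + v) = a *: f u + f v) ->
  cancel f h -> cancel h f -> locally_defined f -> locally_defined h ->
  exists2 g : {linear ellsum F -> ellsum F}, GL g & g = f :> (_ -> _).
Proof.
move=> fl fK hK lf lh; have [g gf] := linear_bundle fl.
exists g => //; split; rewrite gf; first exact: locally_defined_continuous.
by exists h; split=> //; exact: locally_defined_continuous.
Qed.

Lemma locally_defined_shear (N : ellsum F -> ellsum F) :
  (exists B, forall x y, agree B x y -> N x = N y) ->
  locally_defined (fun x => x + N x).
Proof.
move=> [B NB] n x; exists (maxn B n) => y [y1 y2].
have -> : N y = N x.
  by apply/esym/NB; split=> // j jB; apply: y2; rewrite leq_max jB.
split=> [|j jn]; first by rewrite /= y1.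
by rewrite -[LHS]/(y.2 j + (N x).2 j) y2// leq_max jn orbT.
Qed.

Lemma agree_entry s : exists B, forall x y, agree B x y -> entry x s = entry y s.
Proof.
case: s => [i|j]; first by exists 0%N => x y [/= -> _].
by exists j.+1 => x y [_ /= ->].
Qed.

Lemma agree_maxn B B' x y : agree (maxn B B') x y -> agree B x y /\ agree B' x y.
Proof. by move=> [y1 y2]; split; split=> // j jB; apply: y2; rewrite leq_max jB ?orbT. Qed.

Lemma theta_bij (g : ellsum F -> ellsum F) (k : ell F -> ell F) :
  cancel (block_a g) k -> cancel k (block_a g) -> block_a g 0 = 0 -> theta g = 0.
Proof.
move=> gK kK g0; rewrite /theta.
have -> : range (block_a g) = setT.
  by apply/seteqP; split=> // v _; exists (k v).
have -> : [set v | block_a g v = 0] = [set 0].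
  apply/seteqP; split=> v /= => [gv|->//].
  by rewrite -(gK v) gv -g0 gK.
have q0 (A : set (ell F)) : subspace A -> qdim A A = 0%N.
  move=> sA; rewrite /qdim; case: xgetP => [n _ An|//].
  by apply: (quot_dim_uniq sA An); exact: quot_dim0.
by rewrite !q0 ?subrr//; exact: subspace0.
Qed.

(** An element of GL that preserves the dual acts invertibly on the quotient ell,
    and this action is the block a, so that the index vanishes. *)
Lemma parabolicP (g : {linear ellsum F -> ellsum F}) :
  parabolic g <-> GL g /\ g @` @sub_elld F = @sub_elld F.
Proof.
split=> [[[]]//|[Gg gD]]; split=> //; split=> //.
have [_ [h [gK hK _]]] := Gg.
have inD x : x.1 = 0 -> (g x).1 = 0.
  by move=> x1; have : (g @` @sub_elld F) (g x) by [exists x]; rewrite gD.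
have splitx x : x = (x.1, 0) + (0, x.2).
  by case: x => a b; congr pair; rewrite /= ?addr0 ?add0r.
apply: (@theta_bij _ (fun w => (h (w, 0)).1)).
- move=> v; rewrite /block_a.
  have : (@sub_elld F) (g (v, 0) - ((g (v, 0)).1, 0)) by rewrite /sub_elld /= subrr.
  rewrite -gD => -[u u1 gu].
  have -> : ((g (v, 0)).1, 0) = g ((v, 0) - u).
    by rewrite linearB/= gu opprB addrCA subrr addr0.
  by rewrite gK /= u1 subr0.
- move=> w; rewrite /block_a.
  have := hK (w, 0); rewrite {1}[h (w, 0)]splitx linearD => /(congr1 fst)/=.
  by rewrite [X in _ + X]inD// addr0.
- by rewrite /block_a (_ : (0, 0) = 0)// linear0.
Qed.

Definition conjugate L M : Prop :=
  exists2 g : {linear ellsum F -> ellsum F}, parabolic g & M = g @` L.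

Lemma conjugate_trans L M (K : set (ellsum F)) :
  conjugate L M -> conjugate M K -> conjugate L K.
Proof.
move=> [g /parabolicP[[cg [h [gK hK ch]]] gD] ->].
move=> [g' /parabolicP[[cg' [h' [gK' hK' ch']]] gD'] ->].
have [k kE] := @linear_bundle (g' \o g) (fun a u v => linearP (g' \o g) a u v).
exists k; last by rewrite kE image_comp.
apply/parabolicP; rewrite kE; split; last by rewrite -image_comp gD gD'.
split; first by rewrite kE => x; apply: continuous_comp; [exact: cg|exact: cg'].
rewrite kE; exists (h \o h'); split.
- by move=> x; rewrite /= gK' gK.
- by move=> x; rewrite /= hK hK'.
- by move=> x; apply: continuous_comp; [exact: ch'|exact: ch].
Qed.

Lemma conjugate_sym L M : conjugate L M -> conjugate M L.
Proof.
move=> [g /parabolicP[[cg [h [gK hK ch]]] gD] ->].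
have [|k kE] := @linear_bundle h.
  by move=> a u v; apply: (can_inj gK); rewrite linearP !hK.
have hg A : h @` (g @` A) = A.
  by rewrite image_comp (_ : h \o g = id) ?image_id//; apply/funext => x /=.
exists k; last by rewrite kE hg.
apply/parabolicP; rewrite kE; split; last by rewrite -{1}gD hg.
by split; rewrite kE//; exists g.
Qed.

Lemma conjugate_has_dim L M n : conjugate L M ->
  has_dim (L `&` @sub_elld F) n -> has_dim (M `&` @sub_elld F) n.
Proof.
move=> [g /parabolicP[[cg [h [gK hK ch]]] gD] ->] [b [Lb bP]].
exists (fun i => g (b i)); split=> [i|z [[x Lx <-]]].
  have [Li Di] := Lb i; split; first by exists (b i).
  by rewrite -gD; exists (b i).
rewrite -{1}gD => -[y Dy gyx].
have Dx : (@sub_elld F) x by rewrite -(gK x) -gyx gK.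
have [c [cx cU]] := bP x (conj Lx Dx).
have gE (c' : {ffun 'I_n -> F}) :
    g x - \sum_i c' i *: g (b i) = g (x - \sum_i c' i *: b i).
  have gS : g (\sum_i c' i *: b i) = \sum_i c' i *: g (b i).
    by rewrite linear_sum; apply: eq_bigr => i _; rewrite linearZ.
  by rewrite -gS linearB.
exists c; split=> [|c']; rewrite /= gE.
  by have -> : x - \sum_i c i *: b i = 0 by []; rewrite linear0.
have h0 : h 0 = 0 by rewrite -{1}(linear0 g) gK.
by move=> c'x; apply: cU; rewrite /= -[LHS]gK c'x h0.
Qed.

Lemma complements_proj (V : set (nat + nat)) L :
  bounded_dual V -> subspace L -> complements V L ->
  exists p : ellsum F -> ellsum F, [/\ forall x, L (p x),
    forall x s, V s -> entry (p x) s = entry x s &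
    forall a u v, p (a *: u + v) = a *: p u + p v].
Proof.
move=> bV sL cL.
have /choice[p pP] : forall x, exists y, L y /\ forall s, V s -> entry y s = entry x s.
  by move=> x; have [y Ly yx] := complements_ex x bV sL cL; exists y.
exists p; split=> [x|x|a u v]; [exact: (pP x).1|exact: (pP x).2|].
apply: (complements_inj sL cL); first exact: (pP _).1.
  by apply: sL.2; exact: (pP _).1.
by move=> s Vs; rewrite (pP _).2// !entry_lin !(pP _).2.
Qed.

(** With p and q the projections onto L and M along the common complement, the
    map sending x to x - p x + q x carries L to M, and exchanging L and M
    inverts it.  It preserves the dual: the leading position of p x is a
    position of V where x does not vanish, hence belongs to the dual if x
    does. *)
Lemma conjugate_same_pivots (V : set (nat + nat)) L M :
  bounded_dual V -> subspace L -> subspace M ->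
  pivots L = V -> pivots M = V -> conjugate L M.
Proof.
move=> bV sL sM LV MV.
have [cL _] := (pivotsE bV sL).1 LV.
have [cM _] := (pivotsE bV sM).1 MV.
have [p [Lp pE pl]] := complements_proj bV sL cL.
have [q [Mq qE ql]] := complements_proj bV sM cM.
have ext (K : set (ellsum F)) (u : ellsum F -> ellsum F) : subspace K -> complements V K ->
    (forall x, K (u x)) -> (forall x s, V s -> entry (u x) s = entry x s) ->
    forall x y, (forall s, V s -> entry x s = entry y s) -> u x = u y.
  move=> sK cK Ku uE x y xy; apply: (complements_inj sK cK) => // s Vs.
  by rewrite !uE// xy.
have pD (K : set (ellsum F)) (u : ellsum F -> ellsum F) : pivots K = V ->
    (forall x, K (u x)) -> (forall x s, V s -> entry (u x) s = entry x s) ->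
    forall x, x.1 = 0 -> (u x).1 = 0.
  move=> KV Ku uE x x1; have [->//|/has_lead[t [ut u_t]]] := eqVneq (u x) 0.
  have Vt : V t by rewrite -KV; exists (u x).
  move: ut u_t; rewrite uE//; case: t Vt => [i|j] Vt.
    by rewrite /= x1 coef0 eqxx.
  by move=> _ u_t; apply/polyP => i; rewrite coef0; exact: (u_t (inl i)).
have [B VB] := bV.
have agreeV x y : agree B x y -> forall s, V s -> entry x s = entry y s.
  by move=> [y1 y2] [i|j] Vs /=; rewrite ?y1// y2//; exact: VB.
pose f x := x + (q x - p x); pose h x := x + (p x - q x).
have fV x s : V s -> entry (f x) s = entry x s.
  by move=> Vs; rewrite /f entryD entryB qE// pE// subrr addr0.
have hV x s : V s -> entry (h x) s = entry x s.
  by move=> Vs; rewrite /h entryD entryB qE// pE// subrr addr0.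
have fK : cancel f h.
  move=> x; rewrite /h (ext _ _ sL cL Lp pE (f x) x (fV x)).
  by rewrite (ext _ _ sM cM Mq qE (f x) x (fV x)) /f -[p x - q x]opprB addrK.
have hK : cancel h f.
  move=> x; rewrite /f (ext _ _ sL cL Lp pE (h x) x (hV x)).
  by rewrite (ext _ _ sM cM Mq qE (h x) x (hV x)) /h -[q x - p x]opprB addrK.
have [|||g Gg gf] := @GL_bundle f h _ fK hK.
- move=> a u v; rewrite /f pl ql scalerDr scalerBr opprD.
  by rewrite [RHS]addrACA [X in _ = _ + X]addrACA.
- apply: locally_defined_shear; exists B => x y /agreeV xy.
  by rewrite (ext _ _ sL cL Lp pE x y xy) (ext _ _ sM cM Mq qE x y xy).
- apply: locally_defined_shear; exists B => x y /agreeV xy.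
  by rewrite (ext _ _ sL cL Lp pE x y xy) (ext _ _ sM cM Mq qE x y xy).
exists g; last first.
  have pL x : L x -> p x = x.
    by move=> Lx; apply: (complements_inj sL cL) => // s; exact: pE.
  rewrite gf; apply/seteqP; split=> [y My|_ [x Lx <-]]; last first.
    by rewrite /f pL// addrC subrK.
  exists (p y) => //; rewrite /f (pL (p y))// addrC subrK.
  by apply: (complements_inj sM cM) => // s Vs; rewrite qE// pE.
apply/parabolicP; split=> //; rewrite gf.
have fD x : x.1 = 0 -> (f x).1 = 0.
  by move=> x1; rewrite /f /= x1 (pD _ _ LV Lp pE)// (pD _ _ MV Mq qE)// subrr addr0.
have hD x : x.1 = 0 -> (h x).1 = 0.
  by move=> x1; rewrite /h /= x1 (pD _ _ LV Lp pE)// (pD _ _ MV Mq qE)// subrr addr0.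
apply/seteqP; split=> [_ [x Dx <-]|x Dx]; first exact: fD.
by exists (h x); [exact: hD|rewrite hK].
Qed.

Lemma subspace_chartV Om Xi : subspace (chartV (F := F) Om Xi).
Proof.
split=> [s _|a u v u0 v0 s ns]; first by rewrite entry0.
by rewrite entry_lin u0// v0// mulr0 addr0.
Qed.

Lemma pivots_chartV Om Xi : pivots (chartV (F := F) Om Xi) = [set s | inV Om Xi s].
Proof.
apply/seteqP; split=> [s [x Vx [xs _]]|s Vs].
  by apply: contraT => /Vx xs0; rewrite xs0 eqxx in xs.
exists (unit_vec F s).
  by move=> t nt; rewrite entry_unit; case: eqP => // ts; rewrite ts Vs in nt.
split=> [|t ts]; rewrite entry_unit ?eqxx ?oner_neq0//.
by case: eqP => // E; rewrite E before_irr in ts.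
Qed.

Definition swap r s t : nat + nat := if t == r then s else if t == s then r else t.

Lemma swap_conjugate r s Om Xi Om' Xi' : r != s ->
  (if r is inl _ then true else false) = (if s is inl _ then true else false) ->
  (forall t, inV Om' Xi' t = inV Om Xi (swap r s t)) ->
  conjugate (chartV (F := F) Om Xi) (chartV (F := F) Om' Xi').
Proof.
move=> rs ty VV'.
pose f x := x + (entry x s - entry x r) *: (unit_vec F r - unit_vec F s).
have fE x t : entry (f x) t = entry x (swap r s t).
  rewrite /f entryD entryZ entryB !entry_unit /swap.
  have [->|tr] := eqVneq t r.
    by rewrite (negbTE rs) subr0 mulr1 addrC subrK.
  have [->|ts] := eqVneq t s; last by rewrite subrr mulr0 addr0.
  by rewrite sub0r mulrN1 opprB addrC subrK.
have swapK t : swap r s (swap r s t) = t.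
  rewrite /swap; have [->|tr] := eqVneq t r; first by rewrite eq_sym (negbTE rs) eqxx.
  have [->|ts] := eqVneq t s; first by rewrite eqxx.
  by rewrite (negbTE tr) (negbTE ts).
have fK : cancel f f by move=> x; apply: entryP => t; rewrite !fE swapK.
have lf : locally_defined f.
  apply: locally_defined_shear.
  have [B BP] := agree_entry r; have [B' BP'] := agree_entry s.
  exists (maxn B B') => x y /agree_maxn[/BP -> /BP' ->] //.
have [|g Gg gf] := @GL_bundle f f _ fK fK lf lf.
  by move=> a u v; apply: entryP => t; rewrite entry_lin !fE entry_lin.
have fD x : x.1 = 0 -> (f x).1 = 0.
  move=> x1; apply/polyP => i; rewrite coef0.
  have := fE x (inl i); rewrite /= => ->; move: ty; rewrite /swap.
  case: eqP => [<-|_]; first by case: s {rs VV' f fE swapK fK lf gf} => //= k; rewrite x1 coef0.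
  case: eqP => [<-|_ _]; last by rewrite /= x1 coef0.
  by case: r {rs VV' f fE swapK fK lf gf} => //= k; rewrite x1 coef0.
exists g; last first.
  rewrite gf; apply/seteqP; split=> [x Vx|_ [x Vx <-] t nt]; last first.
    by rewrite fE Vx// -VV'.
  exists (f x); last by rewrite fK.
  by move=> t nt; rewrite fE Vx// VV' swapK.
apply/parabolicP; split=> //; rewrite gf.
apply/seteqP; split=> [_ [x Dx <-]|x Dx]; first exact: fD.
by exists (f x); [exact: fD|rewrite fK].
Qed.

(** Sets of equal cardinality are linked by a chain in which each step exchanges
    one element. *)
Lemma fset_exchange (R : {fset nat} -> {fset nat} -> Prop) :
  (forall A, R A A) -> (forall A B C, R A B -> R B C -> R A C) ->
  (forall (A : {fset nat}) i j, i \in A -> j \notin A ->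
    R A (j |` (A `\ i))%fset) ->
  forall A B : {fset nat}, #|` A| = #|` B| -> R A B.
Proof.
move=> R0 RT RX A B; have [n] := ubnP #|` A `\` B|%fset.
elim: n A => // n IH A; rewrite ltnS => An AB.
have [AB0|[i]] := fset_0Vmem (A `\` B)%fset.
  suff -> : A = B :> {fset nat} by [].
  apply/eqP; rewrite eqEfcard AB leqnn andbT -fsetD_eq0; exact/eqP.
rewrite in_fsetD => /andP[iB iA].
have [BA0|[j]] := fset_0Vmem (B `\` A)%fset.
  suff E : B = A :> {fset nat} by rewrite E iA in iB.
  by apply/eqP; rewrite eqEfcard AB leqnn andbT -fsetD_eq0; exact/eqP.
rewrite in_fsetD => /andP[jA jB].
apply: (RT _ _ _ (RX _ _ _ iA jA)); apply: IH.
  apply: leq_trans An.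
  have -> : ((j |` (A `\ i)) `\` B = (A `\` B) `\ i)%fset.
    apply/fsetP => k; rewrite !inE.
    by have [->|_] := eqVneq k j; rewrite ?jB ?andbF//= andbCA.
  by rewrite [X in (_ < X)%N](cardfsD1 i) in_fsetD iA iB.
by rewrite cardfsU1 !inE (negbTE jA) andbF -AB [in RHS](cardfsD1 i) iA.
Qed.

Lemma chartV_conjugate Om Xi Om' Xi' : #|` Om| = #|` Om'| -> #|` Xi| = #|` Xi'| ->
  conjugate (chartV (F := F) Om Xi) (chartV (F := F) Om' Xi').
Proof.
have refl A B : conjugate (chartV (F := F) A B) (chartV (F := F) A B).
  apply: (conjugate_same_pivots (bounded_inV A B)); try exact: subspace_chartV;
  exact: pivots_chartV.
move=> oo xx; apply: (@conjugate_trans _ (chartV (F := F) Om' Xi)).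
  apply: (fset_exchange (R := fun A B => conjugate (chartV A Xi) (chartV B Xi))) => //.
    by move=> A B C; exact: conjugate_trans.
  move=> A i j iA jA; have ij : i != j by apply: contraNneq jA => <-.
  apply: (@swap_conjugate (inl i) (inl j)) => // -[k|k]; rewrite /swap /=.
    rewrite -[inl k == inl i]/(k == i) -[inl k == inl j]/(k == j) !inE.
    have [->|ki] := eqVneq k i; first by rewrite (negbTE ij) /= jA.
    by have [->|kj] := eqVneq k j; rewrite /= ?iA.
  by [].
apply: (fset_exchange (R := fun A B => conjugate (chartV Om' A) (chartV Om' B))) => //.
  by move=> A B C; exact: conjugate_trans.
move=> A i j iA jA; have ij : i != j by apply: contraNneq jA => <-.
apply: (@swap_conjugate (inr i) (inr j)) => // -[k|k]; rewrite /swap //=.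
rewrite -[inr k == inr i]/(k == i) -[inr k == inr j]/(k == j) !inE.
have [->|ki] := eqVneq k i; first by rewrite (negbTE ij) /= (negbTE jA).
by have [->|kj] := eqVneq k j; rewrite /= ?iA.
Qed.

(** The block a of a transvection is a transvection or the identity, hence
    invertible, and the index vanishes. *)
Lemma transvection r s (c : F) : r != s ->
  exists2 g : {linear ellsum F -> ellsum F}, GL0 g &
    forall x, g x = x + (c * entry x r) *: unit_vec F s.
Proof.
move=> rs.
pose f c x := x + (c * entry x r) *: unit_vec F s.
have fr d x : entry (f d x) r = entry x r.
  by rewrite /f entryD entryZ entry_unit (negbTE rs) mulr0 addr0.
have fK d : cancel (f d) (f (- d)).
  by move=> x; rewrite {1}/f fr /f -addrA -scalerDl mulNr subrr scale0r addr0.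
have lf d : locally_defined (f d).
  apply: locally_defined_shear; have [B BP] := agree_entry r.
  by exists B => x y /BP ->.
have fK' : cancel (f (- c)) (f c) by have := fK (- c); rewrite opprK.
have [|g Gg gf] := @GL_bundle (f c) (f (- c)) _ (fK c) fK' (lf c) (lf (- c)).
  move=> a u v; apply: entryP => t.
  by rewrite entry_lin /f !entryD !entryZ; ring.
exists g; last by move=> x; rewrite gf.
split=> //.
have aE d (v : ell F) : (block_a (f d) v, 0) = (v, 0) +
    (d * entry ((v, 0) : ellsum F) r) *: ((unit_vec F s).1, 0) :> ellsum F.
  by congr pair; rewrite /= scaler0 addr0.
have ar d (v : ell F) :
    entry ((block_a (f d) v, 0) : ellsum F) r = entry ((v, 0) : ellsum F) r.
  rewrite aE entryD entryZ.
  suff -> : entry (((unit_vec F s).1, 0) : ellsum F) r = 0 by rewrite mulr0 addr0.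
  case: r s rs {f fr fK lf fK' gf aE} => [i|i] [j|j] //= ij; last by rewrite coef0.
  by rewrite coefXn; case: eqP => // E; rewrite E eqxx in ij.
have aK d : cancel (block_a (f d)) (block_a (f (- d))).
  move=> v; have := aE (- d) (block_a (f d) v); rewrite ar (aE d v) -addrA -scalerDl.
  by rewrite mulNr subrr scale0r addr0 => -[].
rewrite gf; apply: (theta_bij (aK c)).
  by have := aK (- c); rewrite opprK.
rewrite /block_a /f /=; case: r {rs f fr fK lf fK' gf aE ar aK} => i /=;
  by rewrite ?coef0 mulr0 scale0r addr0.
Qed.

End Group.

(** * Borel sets *)

(** Closure properties of an arbitrary sigma-algebra, to be used for the Borel
    sets of the charts as well as for those of the Grassmannian. *)
Section SigmaAlgebra.
Variables (T : Type) (G : set (set T)).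
Hypothesis sG : sigma_algebra setT G.

Lemma sigma_setC A : G A -> G (~` A).
Proof. by case: sG => _ GC _ /GC; rewrite setTD. Qed.

Lemma sigma_exists (I : countType) (P : I -> set T) :
  (forall i, G (P i)) -> G [set x | exists i, P i x].
Proof.
case: sG => G0 _ GU GP.
rewrite (_ : [set x | _] =
  \bigcup_n (if (choice.unpickle n : option I) is Some i then P i else set0)).
  by apply: GU => n; case: (choice.unpickle n).
apply/seteqP; split=> [x [i Pix]|x [n _]].
  by exists (choice.pickle i) => //; rewrite choice.pickleK.
by case: (choice.unpickle n) => // i Pix; exists i.
Qed.

Lemma sigma_forall (I : countType) (P : I -> set T) :
  (forall i, G (P i)) -> G [set x | forall i, P i x].
Proof.
move=> GP; rewrite (_ : [set x | _] = ~` [set x | exists i, (~` P i) x]).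
  by apply/sigma_setC/sigma_exists => i; exact/sigma_setC.
apply/seteqP; split=> [x Px [i nPi]|x Px i]; first exact/nPi/Px.
by apply: contrapT => nPi; apply: Px; exists i.
Qed.

Lemma sigma_cst (A : Prop) : G [set x | A].
Proof.
have [G0 _ _] := sG; have [a|na] := pselect A.
  rewrite (_ : [set x | A] = ~` set0); first exact: sigma_setC.
  by apply/seteqP; split=> x // _ [].
by rewrite (_ : [set x | A] = set0)//; apply/seteqP; split=> x //= /na.
Qed.

Lemma sigma_implies (A : Prop) P : (A -> G P) -> G [set x | A -> P x].
Proof.
have [a|na] := pselect A; last first.
  rewrite (_ : [set x | _] = [set x | True]); first by move=> _; exact: sigma_cst.
  by apply/seteqP; split=> x //= _ /na.
move=> /(_ a) GP; rewrite (_ : [set x | _] = P)//.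
by apply/seteqP; split=> x //=; apply.
Qed.

Lemma sigma_and P Q : G P -> G Q -> G [set x | P x /\ Q x].
Proof.
move=> GP GQ.
rewrite (_ : [set x | _] = [set x | forall b : bool, (if b then P else Q) x]).
  by apply: sigma_forall => -[].
apply/seteqP; split=> [x [Px Qx] []//|x PQ].
by split; [exact: (PQ true)|exact: (PQ false)].
Qed.

End SigmaAlgebra.

Section Measurability.
Variable F : finFieldType.
Implicit Types (x y z : ellsum F) (s t r : nat + nat) (L M : set (ellsum F)).
Implicit Types (Om Xi : {fset nat}) (V : set (nat + nat)).

Section Chart.
Variables Om Xi : {fset nat}.
Local Notation chart := (chart_mx F Om Xi).
Local Notation borel := <<s @open chart >>.

Let sB : sigma_algebra setT borel.
Proof. exact: smallest_sigma_algebra. Qed.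

Lemma chart_mul_ext (T : chart) x y (s : {s | ~~ inV Om Xi s}) :
  (forall r, inV Om Xi r -> entry x r = entry y r) ->
  chart_mul x T s = chart_mul y T s.
Proof. by move=> xy; apply: eq_fsbigr => -[r Vr] _ /=; rewrite xy. Qed.

Lemma chart_mulE x : exists rs : seq {s | inV Om Xi s},
  forall (T : chart) (s : {s | ~~ inV Om Xi s}),
    chart_mul x T s = \sum_(r <- rs) entry x (val r) * T (r, s).
Proof.
pose S := [seq inl i | i <- iota 0 (size (x.1 : {poly F}))] ++
  [seq inr j | j <- enum_fset Xi].
exists (undup (pmap insub S)) => T s.
rewrite /chart_mul (@fsbigE _ _ _ _ _ (undup (pmap insub S)))//.
- by apply: eq_bigl => r; rewrite in_setT.
- exact: undup_uniq.
- move=> [[i|j] Vr] _; rewrite mem_undup mem_pmap_sub mem_cat => /norP[/= nS1 nS2].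
    rewrite nth_default ?mul0r// leqNgt; apply: contra nS1 => ix.
    by rewrite map_f// mem_iota.
  by case/negP: nS2; rewrite map_f.
Qed.

Lemma borel_coord p (c : F) : borel [set T : chart | T p = c].
Proof.
apply: sub_sigma_algebra.
have pc : continuous (fun T : chart => T p : discrete_topology F).
  exact: (@proj_continuous _ (fun=> discrete_topology F) p).
move/continuousP: pc => pc.
exact: (pc [set c] (@discrete_open (discrete_topology F) _)).
Qed.

Lemma borel_chart_mul x (s : {s | ~~ inV Om Xi s}) (c : F) :
  borel [set T : chart | chart_mul x T s = c].
Proof.
have [rs rsE] := chart_mulE x; under eq_set do rewrite rsE.
elim: rs {rsE} c => [|r rs IH] c.
  rewrite (_ : [set T | _] = [set T : chart | 0 = c]).
    exact: (sigma_cst sB (0 = c)).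
  by apply/seteqP; split=> T; rewrite /= big_nil.
rewrite (_ : [set T | _] = [set T : chart | exists d : F, T (r, s) = d /\
    \sum_(r <- rs) entry x (val r) * T (r, s) = c - entry x (val r) * d]).
  by apply: (sigma_exists sB) => d; apply: (sigma_and sB); [exact: borel_coord|exact: IH].
apply/seteqP; split=> T /=; rewrite big_cons.
  by move=> <-; exists (T (r, s)); split=> //; rewrite addrC addKr.
by move=> [d [<- ->]]; rewrite addrC subrK.
Qed.

Lemma complements_chart_graph (T : chart) :
  complements [set s | inV Om Xi s] (chart_graph T).
Proof.
split=> [y yT y0|r Vr]; first exact: chart_kernel yT y0.
pose v := unit_vec F r.
(* Om is finite, so that the part of the row in W has finitely many entries in
   ell. *)
pose N := (\max_(i <- Om) i).+1.
pose c s := if insub s is Some s' then chart_mul v T s' else 0.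
pose w : ellsum F := (\poly_(i < N) c (inl i), fun j => c (inr j)).
have wE s : entry w s = c s.
  case: s => i //=; rewrite coef_poly; case: ltnP => // Ni.
  rewrite /c; case: insubP => [[s ns] /=|//] iO _; move: Ni; rewrite leqNgt => /negP[].
  rewrite ltnS; move: iO; rewrite /= negbK => iO.
  exact: (leq_bigmax_seq (P := xpredT) (F := id) i iO isT).
have w0 s : inV Om Xi s -> entry w s = 0.
  by move=> Vs; rewrite wE /c insubN// negbK.
exists (v + w) => [|s Vs]; last by rewrite entryD w0// addr0 entry_unit.
exists v, w; split=> //.
- by move=> s ns; rewrite entry_unit; case: eqP => // E; rewrite E Vr in ns.
- by move=> s; rewrite wE /c valK.
Qed.

End Chart.

(** A vector of a subspace in a chart is determined by its coordinates along V,
    and countably many coordinates are possible; each of its other entries is a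
    finite linear combination of matrix entries.  The sets needed below are all
    obtained from sets of this form. *)
Lemma measurable_ex_vector (Q : set (nat + nat)) (c : nat + nat -> F) :
  measurable [set L : Gr0 F | exists2 y, val L y & forall s, Q s -> entry y s = c s].
Proof.
move=> Om Xi h.
have sB : sigma_algebra setT <<s @open (chart_mx F Om Xi) >>.
  exact: smallest_sigma_algebra.
pose v (pq : {poly F} * {poly F}) : ellsum F := (pq.1, fun j => pq.2`_j).
rewrite (_ : _ @^-1` _ = [set T : chart_mx F Om Xi | exists pq, forall s,
    Q s -> if insub s is Some s' then chart_mul (v pq) T s' = c s
           else entry (v pq) s = c s]).
  apply: (sigma_exists sB) => pq; apply: (sigma_forall sB) => s.
  apply: (sigma_implies sB) => _; case: insubP => [s' _ _|_].
    exact: borel_chart_mul.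
  exact: (sigma_cst sB).
have bV := bounded_inV Om Xi.
apply/seteqP; split=> T /=.
  move=> [y yT yQ]; have [B BV] := bV.
  pose pq : {poly F} * {poly F} := (y.1, \poly_(j < B) y.2 j).
  have vE r : inV Om Xi r -> entry (v pq) r = entry y r.
    by case: r => [i|j] //= Vj; rewrite coef_poly (BV j Vj).
  exists pq => s Qs; case: insubP => [s' _ s's|/negPn Vs]; last first.
    by rewrite vE// yQ.
  by rewrite (chart_mul_ext _ _ vE) -((chartP _ _).1 yT) s's yQ.
move=> [pq pqQ].
have sT : subspace (chart_graph T) by exact/subspaceP/submod_chart.
have [y yT yE] := complements_ex (v pq) bV sT (complements_chart_graph T).
exists y => // s Qs; have := pqQ _ Qs; case: insubP => [s' _ s's|/negPn Vs].
  have <- : chart_mul y T s' = chart_mul (v pq) T s'.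
    by apply: chart_mul_ext => r /yE.
  by rewrite -s's -((chartP _ _).1 yT).
by rewrite yE.
Qed.

Let sM : sigma_algebra setT (@measurable _ (Gr0 F)).
Proof. exact: sigma_algebra_measurable. Qed.

Lemma measurable_row_entry V r s (c : F) : ~ V s ->
  measurable [set L : Gr0 F | row_entry V (val L) r s c].
Proof.
move=> nVs; pose d t : F := if t == s then c else (t == r)%:R.
have := measurable_ex_vector (V `|` [set s]) d.
congr measurable; apply/seteqP; split=> L.
  move=> [y Ly yd]; exists y; split=> //.
    move=> t Vt; rewrite yd; last by left.
    by rewrite /d; case: eqP => // ts; case: nVs; rewrite -ts.
  by rewrite yd ?/d ?eqxx//; right.
move=> [y [Ly yr ys]]; exists y => // t [Vt|->].
  by rewrite /d; case: eqP => [->//|_]; exact: yr.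
by rewrite /d eqxx.
Qed.

Lemma measurable_complements V :
  measurable [set L : Gr0 F | complements V (val L)].
Proof.
have ker : measurable [set L : Gr0 F |
    forall y, val L y -> (forall s, V s -> entry y s = 0) -> y = 0].
  rewrite (_ : [set L | _] = ~` [set L : Gr0 F | exists s, exists c : F,
      (~ V s /\ c != 0) /\ exists2 y, val L y & forall t, (V `|` [set s]) t ->
        entry y t = if t == s then c else 0]).
    apply: (sigma_setC sM); apply: (sigma_exists sM) => s.
    apply: (sigma_exists sM) => c; apply: (sigma_and sM); first exact: (sigma_cst sM).
    exact: measurable_ex_vector.
  apply/seteqP; split=> L /=.
    move=> LV [s [c [[nVs c0] [y Ly yE]]]].
    have y0 : y = 0.
      apply: LV => // t Vt; rewrite yE; last by left.
      by case: eqP => // ts; case: nVs; rewrite -ts.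
    move: c0; have := yE s (or_intror erefl).
    by rewrite y0 entry0 eqxx => <-; rewrite eqxx.
  move=> no y Ly y0; apply/eqP; apply: contrapT => /negP /has_lead[s [ys _]].
  have nVs : ~ V s by move=> Vs; rewrite y0// eqxx in ys.
  apply: no; exists s, (entry y s); split=> //; exists y => // t [Vt|->].
    by rewrite y0//; case: eqP => // ts; case: nVs; rewrite -ts.
  by rewrite eqxx.
apply: (sigma_and sM ker).
apply: (sigma_forall sM) => r; apply: (sigma_implies sM) => Vr.
exact: measurable_ex_vector.
Qed.

Lemma subspace_Gr0 (L : Gr0 F) : subspace (val L).
Proof. by apply/subspaceP; have := set_mem (valP L) => -[]. Qed.

Lemma measurable_cell Om Xi :
  measurable [set L : Gr0 F | pivots (val L) = [set s | inV Om Xi s]].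
Proof.
pose V : set (nat + nat) := [set s | inV Om Xi s].
rewrite (_ : [set L | _] = [set L : Gr0 F | complements V (val L) /\
    forall r s, V r -> ~ V s -> before s r -> row_entry V (val L) r s 0]).
  apply: (sigma_and sM); first exact: measurable_complements.
  apply: (sigma_forall sM) => r; apply: (sigma_forall sM) => s.
  apply: (sigma_implies sM) => Vr; apply: (sigma_implies sM) => nVs.
  apply: (sigma_implies sM) => _; exact: measurable_row_entry.
have bV := bounded_inV Om Xi.
by apply/seteqP; split=> L /(pivotsE bV (subspace_Gr0 L)).
Qed.

End Measurability.

(** * The measure of the cells *)

Section Cylinders.
Variables (F : finFieldType) (R : realType).
Variable mu : {finite_measure set (Gr0 F) -> \bar R}.
Hypothesis mu_inv : forall g : {linear ellsum F -> ellsum F}, GL0 g ->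
  forall B : set (Gr0 F), measurable B -> mu (translate g B) = mu B.
Hypothesis mu_norm : mu (@graphs F) = 1%E.
Implicit Types (Om Xi : {fset nat}) (V : set (nat + nat)).
Implicit Types (L : set (ellsum F)) (D : seq ((nat + nat) * (nat + nat))).

Let q : R := #|F|%:R.

Let q_neq0 : q != 0.
Proof. by rewrite pnatr_eq0 -lt0n; apply/card_gt0P; exists 0. Qed.

Definition chart_set V : set (Gr0 F) := [set M | complements V (val M)].

Definition cylinder V D : set (Gr0 F) :=
  [set M | chart_set V M /\
    forall p, p \in D -> row_entry V (val M) p.1 p.2 0].

Definition entry_set V r s (c : F) : set (Gr0 F) :=
  [set M | row_entry V (val M) r s c].

Let sM : sigma_algebra setT (@measurable _ (Gr0 F)).
Proof. exact: sigma_algebra_measurable. Qed.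

Lemma measurable_cylinder V D : (forall p, p \in D -> ~ V p.2) ->
  measurable (cylinder V D).
Proof.
move=> DV; apply: (sigma_and sM); first exact: measurable_complements.
apply: (sigma_forall sM) => p; apply: (sigma_implies sM) => pD.
by apply: measurable_row_entry; exact: DV.
Qed.

Section Transvection.
Variables (V : set (nat + nat)) (r s : nat + nat) (c : F).
Variable g : {linear ellsum F -> ellsum F}.
Hypotheses (Vr : V r) (nVs : ~ V s).
Hypothesis gE : forall x, g x = x + (c * entry x r) *: unit_vec F s.

Let entry_g x t : entry (g x) t = entry x t + c * entry x r * (t == s)%:R.
Proof. by rewrite gE entryD entryZ entry_unit. Qed.

Let entry_gV x t : V t -> entry (g x) t = entry x t.
Proof.
move=> Vt; rewrite entry_g; case: eqP => [ts|_]; last by rewrite mulr0 addr0.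
by case: nVs; rewrite -ts.
Qed.

Lemma transvection_complements L : complements V L -> complements V (g @` L).
Proof.
move=> [L0 Lr]; split=> [_ [y Ly <-] gy0|t Vt].
  rewrite (L0 y Ly) ?linear0// => t Vt.
  by rewrite -entry_gV//; exact: gy0.
have [y Ly yt] := Lr _ Vt; exists (g y); first by exists y.
by move=> t' Vt'; rewrite entry_gV// yt.
Qed.

Lemma transvection_row_entry L r' s' a : row_entry V L r' s' a ->
  row_entry V (g @` L) r' s' (a + c * (r == r')%:R * (s' == s)%:R).
Proof.
move=> [y [Ly yr <-]]; exists (g y); split; first by exists y.
- by move=> t Vt; rewrite entry_gV// yr.
- by rewrite entry_g (yr r Vr).
Qed.

End Transvection.

Lemma subspace_image (g : {linear ellsum F -> ellsum F}) L :
  subspace L -> subspace (g @` L).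
Proof.
move=> sL; split=> [|a _ _ [u Lu <-] [v Lv <-]].
  by exists 0; [case: sL|rewrite linear0].
by exists (a *: u + v); [exact: sL.2|rewrite linearP].
Qed.

Lemma translate_cylinder Om Xi D r s c (V := [set t | inV Om Xi t]) :
  #|` Om| = #|` Xi| -> V r -> ~ V s -> (r, s) \notin D ->
  exists2 g : {linear ellsum F -> ellsum F}, GL0 g &
    translate g (cylinder V D `&` entry_set V r s 0) =
    cylinder V D `&` entry_set V r s c.
Proof.
move=> OX Vr nVs rsD.
have rs : r != s by apply: contra_notN nVs => /eqP <-.
have [g Gg gE] := transvection c rs.
have [h _ hE] := transvection (- c) rs.
have hK x : g (h x) = x.
  rewrite gE hE entryD entryZ entry_unit (negbTE rs) mulr0 addr0.
  by rewrite -addrA -scalerDl mulNr addNr scale0r addr0.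
have keep (k : {linear ellsum F -> ellsum F}) d L :
    (forall x, k x = x + (d * entry x r) *: unit_vec F s) ->
    (forall p, p \in D -> row_entry V L p.1 p.2 0) ->
    forall p, p \in D -> row_entry V (k @` L) p.1 p.2 0.
  move=> kE L0 p pD; have := transvection_row_entry Vr nVs kE (L0 _ pD).
  have [rp|] := eqVneq r p.1; last by rewrite mulr0 mul0r addr0.
  have [ps|] := eqVneq p.2 s; last by rewrite mulr0 addr0.
  by case/negP: rsD; rewrite rp -ps -surjective_pairing.
exists g => //; apply/seteqP; split=> [M [N [[cN N0] Nr] MN]|M [[cM M0] Mr]].
  rewrite /cylinder /entry_set /chart_set /= MN; split; [split|].
  - exact: (transvection_complements nVs gE).
  - exact: keep gE N0.
  - have := transvection_row_entry Vr nVs gE Nr.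
    by rewrite !eqxx !mulr1 add0r.
(* The preimage of M under g is again a point of the Grassmannian because it
   lies in the same chart. *)
have sN : subspace (h @` val M) by apply/subspace_image/subspace_Gr0.
have cN := transvection_complements nVs hE cM.
exists (exist _ (h @` val M) (mem_set (complements_Gr0 OX sN cN))) => /=.
  split; [split=> //=|].
    exact: keep hE M0.
  have := transvection_row_entry Vr nVs hE Mr.
  by rewrite !eqxx !mulr1 subrr.
rewrite image_comp (_ : g \o h = id) ?image_id//.
by apply/funext => x /=; rewrite hK.
Qed.

(** The q possible values of an entry cut a cylinder into disjoint pieces which
    are translates of each other. *)
Lemma measure_entry Om Xi D r s c (V := [set t | inV Om Xi t]) :
  #|` Om| = #|` Xi| -> V r -> ~ V s -> (r, s) \notin D ->
  (forall p, p \in D -> ~ V p.2) ->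
  mu (cylinder V D `&` entry_set V r s c) = ((q^-1)%:E * mu (cylinder V D))%E.
Proof.
move=> OX Vr nVs rsD DV.
have mC d : measurable (cylinder V D `&` entry_set V r s d).
  by apply: measurableI; [exact: measurable_cylinder|exact: measurable_row_entry].
have E d : mu (cylinder V D `&` entry_set V r s d) =
    mu (cylinder V D `&` entry_set V r s 0).
  have [g Gg <-] := translate_cylinder d OX Vr nVs rsD.
  by rewrite mu_inv.
have U : cylinder V D = \bigcup_(d in [set: F]) (cylinder V D `&` entry_set V r s d).
  apply/seteqP; split=> [M CM|M [d _ []]//].
  by have [d Md] := row_entry_ex s CM.1 Vr; exists d.
have qE : mu (cylinder V D) =
    (q%:E * mu (cylinder V D `&` entry_set V r s 0%R))%E.
  rewrite {1}U measure_fin_bigcup//.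
  - rewrite (@fsbigE _ _ _ _ _ (enum F)) ?enum_uniq//; last first.
      by move=> d _; rewrite mem_enum.
    rewrite (eq_bigr (fun=> mu (cylinder V D `&` entry_set V r s 0))); last first.
      by move=> d _; exact: E.
    rewrite big_const_seq iter_addr_0 mule_natl; congr (_ *+ _).
    by rewrite (@eq_count _ _ predT) ?count_predT ?cardE// => d; rewrite in_setT.
  - exact: finite_finset.
  - move=> d d' _ _ [M [[[cM _] Md] [_ Md']]].
    exact: (row_entry_uniq (subspace_Gr0 M) cM Md Md').
by rewrite E qE muleA -EFinM mulVf// mul1e.
Qed.

Lemma measure_cylinder Om Xi D (V := [set t | inV Om Xi t]) :
  #|` Om| = #|` Xi| -> uniq D ->
  (forall p, p \in D -> V p.1 /\ ~ V p.2) ->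
  mu (cylinder V D) = ((q^-1 ^+ size D)%:E * mu (chart_set V))%E.
Proof.
move=> OX; elim: D => [_ _|[r s] D IH /= /andP[rsD uD] DV].
  rewrite mul1e; congr (mu _); apply/seteqP; split=> [M []//|M cM].
  by split.
have [Vr nVs] := DV (r, s) (mem_head _ _).
have DV' p : p \in D -> V p.1 /\ ~ V p.2 by move=> pD; apply: DV; rewrite inE pD orbT.
rewrite exprS EFinM -muleA -IH//.
rewrite -(measure_entry 0 OX Vr nVs rsD); last by move=> p /DV'[].
congr (mu _); apply/seteqP; split=> [M [cM M0]|M [[cM M0] Mrs]].
  split; last exact: (M0 _ (mem_head _ _)).
  by split=> // p pD; apply: M0; rewrite inE pD orbT.
by split=> // p; rewrite inE => /predU1P[->//|]; exact: M0.
Qed.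

(** If the matrix of L with respect to V has the entry 1 at (r, s), then
    pivoting on this entry exchanges r for s: the row x of r, which also has
    the entry 1 at s, serves as the new row of s, and the other rows are cleared
    at s by subtracting multiples of x. *)
Lemma pivot_exchange (V V' : set (nat + nat)) L r s : subspace L ->
  V r -> ~ V s -> (forall t, V' t <-> (V t /\ t <> r) \/ t = s) ->
  complements V L -> row_entry V L r s 1 ->
  complements V' L /\ row_entry V' L s r 1.
Proof.
move=> sL Vr nVs VV' cL [x [Lx xr xs]].
have xrr : entry x r = 1 by rewrite xr ?eqxx.
have x0 t : V t -> t <> r -> entry x t = 0.
  by move=> Vt tr; rewrite xr//; case: eqP.
have xV' t : V' t -> entry x t = (t == s)%:R.
  move=> /VV'[[Vt tr]|->]; last by rewrite eqxx.
  by rewrite x0//; case: eqP => // ts; case: nVs; rewrite -ts.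
split; last by exists x; split.
split=> [y Ly y0|t V't].
  have yx : y = entry y r *: x.
    apply: (complements_inj sL cL Ly); first exact: subspaceZ.
    move=> t Vt; rewrite entryZ; have [->|tr] := eqVneq t r; first by rewrite xrr mulr1.
    rewrite x0//; last exact/eqP.
    by rewrite mulr0 y0//; apply/VV'; left; split=> //; apply/eqP.
  have : entry y s = 0 by apply/y0/VV'; right.
  by rewrite yx entryZ xs mulr1 => ->; rewrite scale0r.
move: (V't) => /VV'[[Vt tr]|->]; last by exists x.
have [y Ly yt] := cL.2 _ Vt.
exists (y - entry y s *: x).
  by apply: subspaceB => //; exact: subspaceZ.
move=> t' V't'; rewrite entryB entryZ xV'//.
move: (V't') => /VV'[[Vt' t'r]|->].
  rewrite yt//; case: (t' =P s) => [E|_]; last by rewrite mulr0 subr0.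
  by case: nVs; rewrite -E.
rewrite eqxx mulr1 subrr; case: eqP => // E.
by case: nVs; rewrite E.
Qed.

(** The subspaces whose matrix has the entry 1 at the pivot are a fraction 1/q of
    each of the two charts. *)
Lemma measure_chart_exchange Om Xi i j : #|` Om| = #|` Xi| ->
  i \notin Om -> j \notin Xi ->
  mu (chart_set [set t | inV (i |` Om)%fset (j |` Xi)%fset t]) =
  mu (chart_set [set t | inV Om Xi t]).
Proof.
move=> OX iO jX; set V' := [set t | inV (_ |` _)%fset _ t]; set V := [set t | _].
have OX' : #|` (i |` Om)%fset| = #|` (j |` Xi)%fset| by rewrite !cardfsU1 iO jX OX.
have Vr : V (inl i) by [].
have nVs : ~ V (inr j) by rewrite /V /= (negbTE jX).
have V's : V' (inr j) by rewrite /V' /= !inE eqxx.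
have nV'r : ~ V' (inl i) by rewrite /V' /= !inE eqxx.
have VV' t : V' t <-> (V t /\ t <> inl i) \/ t = inr j.
  rewrite /V /V'; case: t => k /=; rewrite !inE ?negb_or.
    split=> [/andP[ki kO]|[[kO ki]|//]]; first by left; split=> // -[E]; rewrite E eqxx in ki.
    by rewrite kO andbT; apply/eqP => E; case: ki; rewrite E.
  split=> [/predU1P[->|kX]|[[-> _]|[->]]]; rewrite ?eqxx ?orbT//; first by right.
  by left.
have V'V t : V t <-> (V' t /\ t <> inr j) \/ t = inl i.
  rewrite VV'; split=> [Vt|[[[[]//|->//]]|->//]].
  have [->|/eqP ti] := eqVneq t (inl i); first by right.
  by left; split; [left|move=> tj; case: nVs; rewrite -tj].
have E : cylinder V' [::] `&` entry_set V' (inr j) (inl i) 1 =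
    cylinder V [::] `&` entry_set V (inl i) (inr j) 1.
  apply/seteqP; split=> M [[cM _] eM].
    by have [] := pivot_exchange (subspace_Gr0 M) V's nV'r V'V cM eM.
  by have [] := pivot_exchange (subspace_Gr0 M) Vr nVs VV' cM eM.
have C W : cylinder W [::] = chart_set W.
  by apply/seteqP; split=> [M []//|M cM]; split.
have := congr1 mu E; rewrite !measure_entry// !C => /(congr1 (mule q%:E)).
by rewrite !muleA -!EFinM mulfV// !mul1e.
Qed.

Lemma graphs_chart_set : @graphs F = chart_set [set t | inV fset0 fset0 t].
Proof.
apply/seteqP; split=> [_ [T _ <-]|M]; first exact: complements_graph.
move=> /(graphsE (subspace_Gr0 M))[T MT]; exists T => //.
by apply: val_inj; rewrite /= MT.
Qed.

Lemma measure_chart Om Xi : #|` Om| = #|` Xi| ->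
  mu (chart_set [set t | inV Om Xi t]) = 1%E.
Proof.
have [n] := ubnP #|` Om|; elim: n Om Xi => // n IH Om Xi; rewrite ltnS => On OX.
have [ Om0|[i iO]] := fset_0Vmem Om.
  have /eqP := OX; rewrite Om0 cardfs0 eq_sym cardfs_eq0 => /eqP ->.
  by rewrite -graphs_chart_set.
have [X0|[j jX]] := fset_0Vmem Xi.
  by move: OX; rewrite X0 cardfs0 => /eqP; rewrite cardfs_eq0 => /eqP E; rewrite E in iO.
rewrite -(fsetD1K iO) -(fsetD1K jX).
have OX' : #|` (Om `\ i)%fset| = #|` (Xi `\ j)%fset|.
  by move: OX; rewrite (cardfsD1 i) (cardfsD1 j Xi) iO jX => -[].
rewrite measure_chart_exchange ?inE ?eqxx//.
by apply: IH => //; move: On; rewrite (cardfsD1 i) iO.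
Qed.

Definition gaps (A : {fset nat}) m := [seq i <- iota 0 m | i \notin A].

(** The size of the partition whose parts are the numbers of gaps below the
    elements of A. *)
Definition weight (A : {fset nat}) : nat := \sum_(m <- A) size (gaps A m).

(** The positions (r, s) of a matrix for which s comes before r; the matrices that
    vanish there are those in reduced echelon form. *)
Definition echelon_pairs Om Xi : seq ((nat + nat) * (nat + nat)) :=
  [seq (inl i, inl m) | m <- enum_fset Om, i <- gaps Om m] ++
  [seq (inr j, inl m) | m <- enum_fset Om, j <- enum_fset Xi] ++
  [seq (inr j, inr m) | j <- enum_fset Xi, m <- gaps Xi j].

Lemma size_echelon_pairs Om Xi : size (echelon_pairs Om Xi) =
  (#|` Om| * #|` Xi| + weight Om + weight Xi)%N.
Proof.
rewrite !size_cat size_allpairs !size_allpairs_dep !sumnE !big_map.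
by rewrite addnCA addnA.
Qed.

Lemma uniq_echelon_pairs Om Xi : uniq (echelon_pairs Om Xi).
Proof.
rewrite !cat_uniq; apply/and3P; split.
- apply: allpairs_uniq_dep; rewrite ?fset_uniq//.
    by move=> m _; rewrite filter_uniq// iota_uniq.
  by move=> [m i] [m' i'] _ _ /= [-> ->].
- apply/hasPn => p; rewrite mem_cat => /orP[]/allpairsPdep[m [j [_ _ ->]]];
  by apply/negP => /allpairsPdep[m' [j' [_ _ []]]].
apply/and3P; split.
- apply: allpairs_uniq; rewrite ?fset_uniq//.
  by move=> [m i] [m' i'] _ _ /= [-> ->].
- apply/hasPn => p /allpairsPdep[m [j [_ _ ->]]].
  by apply/negP => /allpairsPdep[m' [j' [_ _ []]]].
- apply: allpairs_uniq_dep; rewrite ?fset_uniq//.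
    by move=> m _; rewrite filter_uniq// iota_uniq.
  by move=> [m i] [m' i'] _ _ /= [-> ->].
Qed.

Lemma mem_echelon_pairs Om Xi p : p \in echelon_pairs Om Xi <->
  [/\ inV Om Xi p.1, ~ inV Om Xi p.2 & before p.2 p.1].
Proof.
have mem_gaps A m i : (i \in gaps A m) = (i \notin A) && (i < m)%N.
  by rewrite mem_filter mem_iota.
split=> [|].
  rewrite !mem_cat => /or3P[] /allpairsPdep[a [b [aP bP ->]]] /=;
    move: bP; rewrite ?mem_gaps => bP.
  - by case/andP: bP => bO ba; split=> //; rewrite aP.
  - by split=> //; rewrite aP.
  - by case/andP: bP => bX ba; split=> //; exact/negP.
case: p => -[i|i] [m|m] /= [Vr /negP nVs] b //; rewrite !mem_cat.
- apply/or3P/Or31/allpairsPdep; exists m, i; split=> //; first by rewrite negbK in nVs.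
  by rewrite mem_gaps Vr.
- apply/or3P/Or32/allpairsPdep; exists m, i; split=> //; by rewrite negbK in nVs.
- apply/or3P/Or33/allpairsPdep; exists i, m; split=> //.
  by rewrite mem_gaps nVs.
Qed.

Lemma measure_cell Om Xi : #|` Om| = #|` Xi| ->
  mu [set M : Gr0 F | pivots (val M) = [set t | inV Om Xi t]] =
  (q^-1 ^+ (#|` Om| * #|` Xi| + weight Om + weight Xi))%:E.
Proof.
move=> OX; pose V := [set t | inV Om Xi t].
rewrite (_ : [set M | _] = cylinder V (echelon_pairs Om Xi)).
  rewrite measure_cylinder ?uniq_echelon_pairs//; last first.
    by move=> p /mem_echelon_pairs[].
  by rewrite measure_chart// mule1 size_echelon_pairs.
have bV := bounded_inV Om Xi.
apply/seteqP; split=> M; rewrite /= (pivotsE bV (subspace_Gr0 M)).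
  move=> [cM M0]; split=> // p /mem_echelon_pairs[p1 p2 p12].
  exact: M0.
move=> [cM M0]; split=> // r s Vr nVs sr.
by apply: (M0 (r, s)); apply/mem_echelon_pairs.
Qed.

End Cylinders.

(** * Summation over partitions *)

Section CountableUnion.
Context d (T : measurableType d) (R : realType).

Lemma measure_countable_union (mu : {measure set T -> \bar R}) (I : countType)
    (D : set I) (C : I -> set T) :
  (forall i, D i -> measurable (C i)) -> trivIset D C ->
  mu (\bigcup_(i in D) C i) = \esum_(i in D) mu (C i).
Proof.
move=> mC tC.
pose C' n := if (choice.unpickle n : option I) is Some i then C i else set0.
pose D' := [set choice.pickle i | i in D].
have CE i : C' (choice.pickle i) = C i by rewrite /C' choice.pickleK.
have -> : \bigcup_(i in D) C i = \bigcup_(n in D') C' n.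
  by rewrite bigcup_image; apply: eq_bigcupr => i _; rewrite CE.
rewrite measure_bigcup; first 1 last.
- by move=> _ [i Di <-]; rewrite CE; exact: mC.
- by move=> _ _ [i Di <-] [j Dj <-]; rewrite !CE => /(tC _ _ Di Dj) ->.
rewrite nneseries_esum; last by move=> n _; exact: measure_ge0.
rewrite (_ : [set x | x \in D'] = D'); last first.
  by apply/seteqP; split=> n /=; rewrite inE.
rewrite (@reindex_esum _ _ _ D D' choice.pickle); last first.
  split; first by move=> i Di; exists i.
    by move=> i j _ _ /(pcan_inj choice.pickleK).
  by move=> _ [i Di <-]; exists i.
by apply: eq_esum => i _; rewrite CE.
Qed.

End CountableUnion.

Section GeneratingFunction.
Implicit Types (A B : {fset nat}) (a i m : nat).

(** Every set of k+1 numbers is of this form for exactly one a, its least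
    element, and one set A of k numbers. *)
Definition cons_set a A : {fset nat} :=
  (a |` [fset (a.+1 + i)%N | i in A])%fset.

Lemma cons_setS a A i : ((a.+1 + i)%N \in cons_set a A) = (i \in A).
Proof.
rewrite !inE gtn_eqF ?ltnS ?leq_addr//=.
by apply/imfsetP/idP => [[j jA /addnI ->]//|iA]; exists i.
Qed.

Lemma cons_set_lt a A i : (i < a)%N -> i \notin cons_set a A.
Proof.
move=> ia; rewrite !inE negb_or ltn_eqF//=.
by apply/imfsetP => -[j _ /= E]; lia.
Qed.

Lemma cons_set_notin a A : a \notin [fset (a.+1 + i)%N | i in A]%fset.
Proof. by apply/imfsetP => -[j _ /eqP]; rewrite ltn_eqF// ltnS leq_addr. Qed.

Lemma card_cons_set a A : #|` cons_set a A| = (#|` A|).+1.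
Proof.
by rewrite cardfsU1 cons_set_notin card_imfset// => i j /addnI.
Qed.

(** The a numbers below the least element are gaps for each of the elements. *)
Lemma weight_cons_set a A :
  weight (cons_set a A) = ((#|` A|).+1 * a + weight A)%N.
Proof.
have gaps0 : gaps (cons_set a A) a = iota 0 a.
  apply/all_filterP/allP => i; rewrite mem_iota => /= ia; exact: cons_set_lt.
have gapsS i : size (gaps (cons_set a A) (a.+1 + i)) = (a + size (gaps A i))%N.
  rewrite {1}/gaps iotaD filter_cat size_cat; congr addn.
    rewrite -addn1 iotaD filter_cat size_cat -/(gaps _ a) gaps0 size_iota /=.
    by rewrite !inE eqxx addn0.
  rewrite addnC iotaDl filter_map size_map; congr size.
  by apply: eq_filter => j /=; rewrite cons_setS.
rewrite /weight big_fsetU1 ?cons_set_notin//= gaps0 size_iota.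
rewrite big_imfset/=; last by move=> i j _ _ /addnI.
under eq_bigr do rewrite gapsS.
by rewrite big_split/= big_const_seq count_predT iter_addn_0 mulSn -addnA mulnC.
Qed.

Lemma cons_set_inj a A a' A' : cons_set a A = cons_set a' A' -> a = a' /\ A = A'.
Proof.
move=> E; have aa' : a = a'.
  have lt b B b' B' : cons_set b B = cons_set b' B' -> ~ (b < b')%N.
    move=> /fsetP /(_ b) + bb'; rewrite (negbTE (cons_set_lt _ bb')).
    by rewrite !inE eqxx.
  by case: (ltngtP a a') => // /lt; [case/(_ _ _ E)|case/(_ _ _ (esym E))].
split=> //; subst a'; apply/fsetP => i.
by rewrite -(cons_setS a A) E cons_setS.
Qed.

Lemma cons_set_surj k B : #|` B| = k.+1 ->
  exists a A, #|` A| = k /\ cons_set a A = B.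
Proof.
move=> Bk; have [b bB] : exists b, b \in B.
  by apply/fset0Pn; rewrite -cardfs_gt0 Bk.
pose a := ex_minn (ex_intro (fun b => b \in B) b bB).
have [aB min_a] : a \in B /\ forall m, m \in B -> (a <= m)%N.
  by rewrite /a; case: ex_minnP.
pose A := [fset (m - a.+1)%N | m in (B `\ a)%fset]%fset.
have AE i : (i \in A) = ((a.+1 + i)%N \in B).
  apply/imfsetP/idP => [[m /=]|iB].
    rewrite !inE => /andP[ma mB] ->; rewrite subnKC// ltn_neqAle eq_sym ma.
    exact: min_a.
  by exists (a.+1 + i)%N; rewrite ?addKn//= !inE iB andbT gtn_eqF// ltnS leq_addr.
have AB : cons_set a A = B.
  apply/fsetP => i; have [ia|ia|->] := ltngtP i a.
  - rewrite (negbTE (cons_set_lt _ ia)); apply/esym/negP => /min_a.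
    by rewrite leqNgt ia.
  - by rewrite -(subnKC ia) cons_setS AE.
  - by rewrite !inE eqxx aB.
exists a, A; split=> //.
by apply/eqP; rewrite -eqSS -(card_cons_set a) AB Bk.
Qed.

Variable R : realType.

Lemma esum_geometric (c z : R) : 0 <= c -> 0 <= z < 1 ->
  \esum_(a in [set: nat]) (c * z ^+ a)%:E = (c / (1 - z))%:E.
Proof.
move=> c0 /andP[z0 z1]; rewrite -nneseries_esumT; last first.
  by move=> n; rewrite lee_fin mulr_ge0// exprn_ge0.
apply/cvg_lim => //.
rewrite (_ : (fun n => _) = EFin \o series (geometric c z)); last first.
  by apply/funext => n; rewrite /= /series /= sumEFin.
apply: cvg_EFin; first exact: nearW.
by apply: cvg_geometric_series; rewrite ger0_norm.
Qed.

(** The generating function of the partitions with at most k parts: the least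
    element of the set contributes a geometric series of ratio x^k.  The factor
    c makes it possible to sum over one variable at a time. *)
Lemma esum_weight (x c : R) k : 0 < x < 1 -> 0 <= c ->
  \esum_(A in [set A : {fset nat} | #|` A| = k]) (c * x ^+ weight A)%:E =
  (c / \prod_(1 <= j < k.+1) (1 - x ^+ j))%:E.
Proof.
move=> /andP[x0 x1]; elim: k c => [|k IH] c c0.
  rewrite big_geq// divr1 (_ : [set A | _] = [set fset0]).
    by rewrite esum_set1 /weight big_seq_fset0 ?mulr1// lee_fin mulr_ge0.
  apply/seteqP; split=> A /=; first by move/eqP; rewrite cardfs_eq0 => /eqP.
  by move=> ->; rewrite cardfs0.
pose S := [set: nat] `*`` (fun=> [set A : {fset nat} | #|` A| = k]).
rewrite (@reindex_esum _ _ _ S _ (fun p => cons_set p.1 p.2)); last first.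
  split=> [[a A] [_ /= Ak]|[a A] [a' A'] _ _ /= /cons_set_inj[-> ->]//|B /= Bk].
    by rewrite card_cons_set Ak.
  by have [a [A [Ak AB]]] := cons_set_surj Bk; exists (a, A).
rewrite /S -(@esum_esum _ _ _ _ _
  (fun a A => (c * x ^+ weight (cons_set a A))%:E)); last first.
  by move=> a A _ _; rewrite lee_fin mulr_ge0// exprn_ge0// ltW.
set P := \prod_(1 <= j < k.+1) (1 - x ^+ j) in IH *.
have E a : \esum_(A in [set A : {fset nat} | #|` A| = k])
    (c * x ^+ weight (cons_set a A))%:E = (c / P * (x ^+ k.+1) ^+ a)%:E.
  rewrite -[RHS]/(_%:E) mulrAC -IH; last by rewrite mulr_ge0// !exprn_ge0// ltW.
  apply: eq_esum => A Ak; rewrite weight_cons_set Ak exprD exprM mulrA.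
  by [].
under eq_esum do rewrite E.
have xk j : (0 < j)%N -> 0 <= x ^+ j < 1.
  by move=> j0; rewrite exprn_ge0 ?(ltW x0)//= exprn_ilt1 ?(ltW x0) ?lt0n_neq0.
rewrite esum_geometric ?xk//.
  by rewrite big_nat_recr//= invfM mulrA.
rewrite divr_ge0//; apply: prodr_ge0 => j _; rewrite subr_ge0.
by rewrite exprn_ile1// ltW.
Qed.

End GeneratingFunction.

(** * Strata *)

Section Strata.
Variable F : finFieldType.
Implicit Types (M N : Gr0 F) (Om Xi : {fset nat}) (k : nat).

Definition cell Om Xi : set (Gr0 F) :=
  [set M | pivots (val M) = [set s | inV Om Xi s]].

Definition subsets_of_card k : set {fset nat} := [set A | #|` A| = k].

Lemma has_dim_uniq (L : set (ellsum F)) m n : has_dim L m -> has_dim L n -> m = n.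
Proof. exact: quot_dim_uniq (@subspace0 _ _). Qed.

Lemma Gr0_cell M : exists Om Xi, #|` Om| = #|` Xi| /\ cell Om Xi M.
Proof. exact: Gr0_pivots (set_mem (valP M)). Qed.

Lemma cell_stratum Om Xi M : cell Om Xi M -> stratum #|` Xi| M.
Proof. exact: has_dim_pivots (subspace_Gr0 M). Qed.

Lemma stratum_cell k M : stratum k M ->
  exists Om Xi, [/\ #|` Om| = k, #|` Xi| = k & cell Om Xi M].
Proof.
move=> Mk; have [Om [Xi [OX MOX]]] := Gr0_cell M; exists Om, Xi.
by rewrite OX (has_dim_uniq (cell_stratum MOX) Mk).
Qed.

Lemma stratum_neq0 k : exists M, stratum k M.
Proof.
pose A := [fset i | i in iota 0 k]%fset.
have Ak : #|` A| = k by rewrite card_fseq undup_id ?iota_uniq// size_iota.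
have sA : subspace (chartV (F := F) A A) := subspace_chartV F A A.
have [cA _] := (pivotsE (bounded_inV A A) sA).1 (pivots_chartV F A A).
pose M : Gr0 F := exist _ (chartV A A) (mem_set (complements_Gr0 erefl sA cA)).
exists M; rewrite -Ak; apply: (@cell_stratum A A M); exact: pivots_chartV.
Qed.

Lemma stratum_conjugate k M N : stratum k M -> stratum k N ->
  conjugate (val M) (val N).
Proof.
have std Om Xi (K : Gr0 F) : cell Om Xi K -> conjugate (val K) (chartV Om Xi).
  move=> cK; apply: (conjugate_same_pivots (bounded_inV Om Xi)) => //.
  - exact: subspace_Gr0.
  - exact: subspace_chartV.
  - exact: pivots_chartV.
move=> /stratum_cell[Om [Xi [Omk Xik cM]]] /stratum_cell[Om' [Xi' [Omk' Xik' cN]]].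
apply: conjugate_trans (std _ _ _ cM) _.
apply: conjugate_trans (conjugate_sym (std _ _ _ cN)).
by apply: chartV_conjugate; rewrite ?Omk ?Xik.
Qed.

Lemma parabolic_orbitE k M : stratum k M -> parabolic_orbit M = stratum k.
Proof.
move=> Mk; apply/seteqP; split=> N.
  move=> [g Pg NE]; rewrite /stratum /=.
  by apply: conjugate_has_dim Mk; exists g.
by move=> /(stratum_conjugate Mk)[g Pg NE]; exists g.
Qed.

Lemma orbits_strata : set_bij [set: nat] (@parabolic_orbits F) (@stratum F).
Proof.
split=> [k _|k k' _ _ E|_ [M _ <-]].
- by have [M Mk] := stratum_neq0 k; exists M => //; exact: parabolic_orbitE.
- have [M Mk] := stratum_neq0 k.
  by apply: (has_dim_uniq Mk); have : stratum k M by []; rewrite E.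
- have [Om [Xi [_ /cell_stratum MX]]] := Gr0_cell M.
  by exists #|` Xi| => //; rewrite (parabolic_orbitE MX).
Qed.

Lemma stratumE k : stratum k =
  \bigcup_(p in subsets_of_card k `*`` (fun=> subsets_of_card k)) cell p.1 p.2.
Proof.
apply/seteqP; split=> [M /stratum_cell[Om [Xi [Omk Xik cM]]]|M [p [/= _ <-]]].
  by exists (Om, Xi).
exact: cell_stratum.
Qed.

Lemma trivIset_cell D : trivIset D (fun p => cell p.1 p.2).
Proof.
move=> [A B] [A' B'] _ _ [M [/= MA]]; rewrite /cell /= MA => E.
have E' s : inV A B s = inV A' B' s.
  by have := congr1 (fun V : set (nat + nat) => V s) E; rewrite /= propeqE => sE;
    apply/idP/idP => /sE.
congr pair; apply/fsetP => i; last exact: (E' (inr i)).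
by apply: negb_inj; exact: (E' (inl i)).
Qed.

Lemma measurable_stratum k : measurable (@stratum F k).
Proof.
rewrite stratumE bigcup_mkcond.
apply: countable_bigcupT_measurable => [|p]; first exact: countableP.
case: ifP => _; [exact: measurable_cell|exact: measurable0].
Qed.

Lemma measure_stratum (R : realType) (mu : {finite_measure set (Gr0 F) -> \bar R})
    (q : R := #|F|%:R) k :
  (forall g : {linear ellsum F -> ellsum F}, GL0 g ->
    forall B : set (Gr0 F), measurable B -> mu (translate g B) = mu B) ->
  mu (@graphs F) = 1%E ->
  mu (stratum k) =
    (q ^- (k ^ 2) / \prod_(1 <= j < k.+1) (1 - q ^- j) ^+ 2)%:E.
Proof.
move=> mu_inv mu_norm.
pose x := q^-1.
have q1 : 1 < q by rewrite ltr1n card_finNzRing_gt1.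
have x01 : 0 < x < 1.
  by rewrite invr_gt0 (lt_trans _ q1)//= invf_lt1// (lt_trans _ q1).
have x0 : 0 <= x by case/andP: x01 => /ltW.
rewrite stratumE measure_countable_union; first last.
- exact: trivIset_cell.
- by move=> p _; exact: measurable_cell.
set D := subsets_of_card k.
rewrite (@eq_esum _ _ _ _ (fun p : {fset nat} * {fset nat} =>
    (x ^+ (k ^ 2) * x ^+ weight p.1 * x ^+ weight p.2)%:E)); last first.
  move=> [Om Xi] [/= Omk Xik].
  rewrite (measure_cell mu_inv mu_norm) ?Omk ?Xik//.
  by rewrite -/q -/x !exprD mulnn.
rewrite -(@esum_esum _ _ _ _ _ (fun A B : {fset nat} =>
    (x ^+ (k ^ 2) * x ^+ weight A * x ^+ weight B)%:E)); last first.
  by move=> A B _ _; rewrite lee_fin !mulr_ge0// exprn_ge0.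
set P := \prod_(1 <= j < k.+1) (1 - x ^+ j).
have P0 : 0 <= P.
  apply: prodr_ge0 => j _; rewrite subr_ge0 exprn_ile1//.
  by case/andP: x01 => _ /ltW.
under eq_esum do rewrite esum_weight ?mulr_ge0 ?exprn_ge0// mulrAC.
rewrite esum_weight ?divr_ge0 ?exprn_ge0//.
congr EFin; rewrite -mulrA -invfM -/P /x exprVn; congr (_ / _).
under [in RHS]eq_bigr do rewrite -exprVn.
by rewrite prodrXl expr2.
Qed.

End Strata.

Theorem proposition1p4 (F : finFieldType) (R : realType)
    (mu : {finite_measure set (Gr0 F) -> \bar R})
    (mu_inv : forall g : {linear ellsum F -> ellsum F}, GL0 g ->
      forall B : set (Gr0 F), measurable B -> mu (translate g B) = mu B)
    (mu_norm : mu (@graphs F) = 1%E) :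
  set_bij [set: nat] (@parabolic_orbits F) (@stratum F) /\
  forall k : nat,
    measurable (@stratum F k) /\
    let q : R := #|F|%:R in
    mu (@stratum F k) =
      (q ^- (k ^ 2) / \prod_(1 <= j < k.+1) (1 - q ^- j) ^+ 2)%:E.

Proof.
split; first exact: orbits_strata.
move=> k; split; first exact: measurable_stratum.
exact: measure_stratum.
Qed.
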